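(* The following statements are equivalent for two maps $\phi_1,\phi_2:\langle\mathbf{RS}_n\rangle\to\langle\mathbf{RS}_n\rangle$: (1) $\operatorname{spec}(\phi_1(A_1)\phi_2(A_2))=\operatorname{spec}(A_1A_2)$ for all $A_1,A_2\in\langle\mathbf{RS}_n\rangle$. (2) $\operatorname{tr}(\phi_1(A_1)\phi_2(A_2))=\operatorname{tr}(A_1A_2)$ for all $A_1,A_2\in\langle\mathbf{RS}_n\rangle$. Moreover, there is $p\in\{1,2\}$ such that $A\in\langle\mathbf{DS}_n\rangle$ and $\operatorname{rank}(A)\le1$ imply that $\operatorname{rank}\phi_p(A)\le1$. (3) One of the following statements holds: (a) When $n=2$, there are an invertible $C\in\langle\mathbf{DS}_2\rangle$ and $P\in\left\{I_2,\begin{pmatrix}1&0\\0&-1\end{pmatrix}\right\}$ such that $\phi_1(A)_{\mathbf{DS}}=CPA_{\mathbf{DS}}P^{-1}$ and $\phi_2(A)_{\mathbf{DS}}=PA_{\mathbf{DS}}P^{-1}C^{-1}$ for all $A\in\langle\mathbf{RS}_n\rangle$. (b) When $n\ge3$, there exist invertible matrices $P,Q\in\langle\mathbf{DS}_n\rangle$ such that either $\phi_1(A)_{\mathbf{DS}}=PA_{\mathbf{DS}}Q^{-1}$ and $\phi_2(A)_{\mathbf{DS}}=QA_{\mathbf{DS}}P^{-1}$ for all $A\in\langle\mathbf{RS}_n\rangle$, or $\phi_1(A)_{\mathbf{DS}}=P(A_{\mathbf{DS}})^tQ^{-1}$ and $\phi_2(A)_{\mathbf{DS}}=Q(A_{\mathbf{DS}})^tP^{-1}$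 for all $A\in\langle\mathbf{RS}_n\rangle$.
   Context: $\mathbf{DS}_n$ (resp. $\mathbf{RS}_n$) is the set of $n\times n$ doubly stochastic (resp. row stochastic) matrices: real, entrywise nonnegative, with all row sums and column sums (resp. all row sums) equal to $1$. $\langle\cdot\rangle$ denotes the real linear span. Let $e=(1,\ldots,1)^t\in\mathbb{R}^n$ and $R_n=\{ev^t: v\in\mathbb{R}^n,\ v^te=0\}$. One has the vector space direct sum $\langle\mathbf{RS}_n\rangle=\langle\mathbf{DS}_n\rangle\oplus R_n$, and for $A=[a_{ij}]\in\langle\mathbf{RS}_n\rangle$ we write $A=A_{\mathbf{DS}}+A_R$ with $A_{\mathbf{DS}}\in\langle\mathbf{DS}_n\rangle$ and $A_R\in R_n$; explicitly, $A_R=er^t$ where $r=(r_1,\ldots,r_n)^t$, $r_i=\frac1n\sum_{k}a_{ki}-\frac1{n^2}\sum_{k,l}a_{kl}$, and $A_{\mathbf{DS}}=A-A_R$. $A^t$ is the transpose of $A$, and $\operatorname{tr}$ is the trace. $\operatorname{spec}(A)$ is the spectrum (multiset of complex eigenvalues) counting multiplicities. The maps are not assumed linear.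
   Formalization: In (2) the rank condition is rank(φ_p(A)_DS) ≤ 1 instead of rank φ_p(A) ≤ 1; as printed, (1) and (3) do not imply (2) for n ≥ 3, since they leave φ_p(A)_R arbitrary (e.g. n=3, φ1(A)=φ2(A)=A+e(1,−1,0)). Also n ≥ 2 is made explicit. *)

(* Defs.v *)
From HB Require Import structures.
From mathcomp Require Import all_boot all_order all_algebra.
From mathcomp Require Import complex.
From mathcomp Require Import classical_sets functions reals.

Set Implicit Arguments.
Unset Strict Implicit.
Unset Printing Implicit Defensive.

Import Order.TTheory GRing.Theory Num.Theory.

Local Open Scope ring_scope.
Local Open Scope classical_set_scope.

Definition linear_span (R : nzRingType) (V : lmodType R) (S : set V) : set V :=
  [set v | exists (k : nat) (c : 'I_k -> R) (s : 'I_k -> V),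
     (forall i, S (s i)) /\ v = \sum_i c i *: s i].

Definition row_stochastic (R : realType) (n : nat) : set 'M[R]_n :=
  [set A | (forall i j, 0 <= A i j) /\ (forall i, \sum_j A i j = 1)].

Definition doubly_stochastic (R : realType) (n : nat) : set 'M[R]_n :=
  [set A | [/\ forall i j, 0 <= A i j, forall i, \sum_j A i j = 1
             & forall j, \sum_i A i j = 1]].

Definition spanRS (R : realType) (n : nat) : set 'M[R]_n :=
  linear_span (@row_stochastic R n).

Definition spanDS (R : realType) (n : nat) : set 'M[R]_n :=
  linear_span (@doubly_stochastic R n).

(* For A in spanRS, the two definitions below are the components of A in the
   direct sum <RS_n> = <DS_n> (+) { e v^T | v^T e = 0 }, with e the all-ones
   column vector. *)
Definition R_part (R : realType) (n : nat) (A : 'M[R]_n) : 'M[R]_n :=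
  (const_mx 1 : 'cV[R]_n) *m
  \row_i (n%:R^-1 * (\sum_k A k i) - (n ^ 2)%:R^-1 * (\sum_k \sum_l A k l)).

Definition DS_part (R : realType) (n : nat) (A : 'M[R]_n) : 'M[R]_n :=
  A - R_part A.

(* The complex roots of the characteristic polynomial, each listed as often as
   its multiplicity. The order of the list is arbitrary, so spectra are to be
   compared with perm_eq. *)
Definition spec (R : realType) (n : nat) (A : 'M[R]_n) : seq (complex R) :=
  sval (closed_field_poly_normal (char_poly (map_mx (real_complex R) A))).

(* diag(1, -1) when n = 2 *)
Definition alt_sign_mx (R : realType) (n : nat) : 'M[R]_n :=
  diag_mx (\row_(i < n) (-1) ^+ i).

(* Main.v *)
Require Import Defs.
From mathcomp Require Import all_boot all_order all_algebra.
From mathcomp Require Import complex.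
From mathcomp Require Import classical_sets functions reals.
From mathcomp Require Import boolp ring lra.
Local Open Scope ring_scope.
Set Implicit Arguments.
Unset Strict Implicit.
Unset Printing Implicit Defensive.
Import Order.TTheory GRing.Theory Num.Theory.

(** A matrix A lies in <RS_n> iff the all-ones vector e is an eigenvector of
    A, and in <DS_n> iff e is an eigenvector of both A and its transpose. Let
    H be the reflection that sends e to a multiple of the first basis vector.
    Conjugation by H is an involution preserving products, traces, transposes
    and ranks. It turns <RS_n> into the block triangular matrices
    [[c, s], [0, B]] with c a scalar and B square of size n - 1, turns <DS_n>
    into the block diagonal ones (s = 0), and turns A |-> A_DS into the
    erasure of s. Hence spec(A1 A2), and with it tr(A1 A2), depends only on
    the parts A1_DS and A2_DS ([conj_by_DS_part], [char_poly_DS_part]), which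
    gives (3) => (1).

    The form (X, Y) |-> tr(X Y) is nondegenerate on <DS_n>. Two maps that
    preserve it act linearly and bijectively on DS parts, the second being the
    inverse of the adjoint of the first ([pairing_preserver_linear],
    [trace_preserver_coords], [adjoint_mulmx]).

    For (1) => (2), equality of spectra is equality of characteristic
    polynomials, and gives equality of tr M and of tr(M^2) for M = A1 A2. If
    A1 in <DS_n> has rank at most one, then (tr M)^2 = tr(M^2). Choose A2 in
    <DS_n> with phi_2(A2)_DS = Y^t, where Y = phi_1(A1)_DS: the same relation
    for Y Y^t says that the sum of the squared 2x2 minors of Y is zero
    ([rank_le1_gram]), so Y has rank at most one.

    For (2) => (3), say that phi_1 preserves rank at most one; the other case
    is symmetric, for n = 2 because <DS_2> is commutative. In block coordinates there is a linear bijection of the pairs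
    (c, B) preserving rank at most one. If n >= 3 it maps (0, B) to
    (0, T B) and (1, 0) to a multiple of (1, 0) ([block_preserver]), and T is
    a bijective preserver of rank one, hence B |-> U B V or B |-> U B^t V by a
    theorem of Marcus and Moyls ([rank_one_preserver]). If n = 2 the pairs are
    pairs of scalars and those of rank at most one form the coordinate axes,
    which are preserved or exchanged ([block_preserver1]); conjugation by
    diag(1, -1) is the exchange ([alt_sign_swap]). *)

(** * Spectra and characteristic polynomials *)

Lemma spec_perm_eqP (R : realType) (n : nat) (A B : 'M[R]_n) :
  reflect (char_poly A = char_poly B) (perm_eq (spec A) (spec B)).
Proof.
have specE (M : 'M[R]_n) :
    map_poly (real_complex R) (char_poly M) = \prod_(z <- spec M) ('X - z%:P).
  rewrite map_char_poly /spec; case: closed_field_poly_normal => s /= {1}->.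
  by rewrite (monicP (char_poly_monic _)) scale1r.
apply: (iffP idP) => [sAB | cAB].
  apply: (map_poly_inj (real_complex R)).
  by rewrite !specE (perm_big _ sAB).
by rewrite /spec -!map_char_poly cAB.
Qed.

Lemma char_poly_tr (F : comNzRingType) (n : nat) (A : 'M[F]_n) :
  char_poly A^T = char_poly A.
Proof.
rewrite /char_poly -[RHS]det_tr /char_poly_mx; congr (\det _).
by rewrite linearB /= tr_scalar_mx map_trmx.
Qed.

(** Both products come from the block matrix [['X, A], [B, 1]], reduced once
    by column operations and once by row operations. *)
Lemma char_poly_mulC (F : idomainType) (n : nat) (A B : 'M[F]_n) :
  char_poly (A *m B) = char_poly (B *m A).
Proof.
pose Ax : 'M_n := map_mx polyC A; pose Bx : 'M_n := map_mx polyC B.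
pose M := block_mx ('X%:M : 'M_n) Ax Bx 1%:M.
have ->: char_poly (A *m B) = \det M.
  have E : M *m block_mx 1%:M 0 (- Bx) 1%:M
           = block_mx (char_poly_mx (A *m B)) Ax 0 1%:M.
    rewrite mulmx_block !(mulmx0, mulmx1, mul1mx, mulmxN, add0r) addrN.
    by rewrite /char_poly_mx map_mxM.
  move/(congr1 determinant): E.
  by rewrite det_mulmx det_lblock det_ublock !det1 !mulr1 => ->.
have E : block_mx 1%:M 0 (- Bx) 'X%:M *m M
         = block_mx 'X%:M Ax 0 (char_poly_mx (B *m A)).
  rewrite mulmx_block !(mul0mx, mulmx1, mul1mx, mulNmx, addr0).
  rewrite mul_mx_scalar mul_scalar_mx addNr /char_poly_mx map_mxM.
  by rewrite addrC.
move/(congr1 determinant): E.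
rewrite det_mulmx det_lblock det_ublock !det1 !mul1r => /mulfI -> //.
by rewrite det_scalar expf_neq0 // polyX_eq0.
Qed.

Lemma char_poly_conj (F : fieldType) (n : nat) (P A : 'M[F]_n) :
  P \in unitmx -> char_poly (P *m A *m invmx P) = char_poly A.
Proof. by move=> uP; rewrite char_poly_mulC mulmxA mulVmx // mul1mx. Qed.

Lemma char_poly_eq_trace (F : nzRingType) (n : nat) (A B : 'M[F]_n) :
  char_poly A = char_poly B -> \tr A = \tr B.
Proof.
case: n A B => [|n] A B cAB; first by rewrite /mxtrace !big_ord0.
by apply: oppr_inj; rewrite -!char_poly_trace // cAB.
Qed.

(** Since det ('X^2 - A^2) = det ('X - A) det ('X + A), the characteristic
    polynomial of A determines that of A^2. *)
Lemma char_poly_eq_trace_sq (F : comNzRingType) (n : nat) (A B : 'M[F]_n) :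
  char_poly A = char_poly B -> \tr (A *m A) = \tr (B *m B).
Proof.
have sqE (M : 'M[F]_n) : char_poly (M *m M) \Po 'X^2
    = char_poly M * ((-1) ^+ n * (char_poly M \Po - 'X)).
  have compE (p : {poly F}) (N : 'M[F]_n) :
      char_poly N \Po p = \det (p%:M - map_mx polyC N).
    rewrite -[LHS]/(comp_poly p _) /char_poly -det_map_mx; congr (\det _).
    rewrite /char_poly_mx map_mxB map_scalar_mx /= comp_polyX; congr (_ - _).
    by apply/matrixP => i j; rewrite !mxE comp_polyC.
  rewrite !compE -detZ -det_mulmx; congr (\det _).
  rewrite scaleN1r opprB raddfN /= opprK mulmxBl !mulmxDr map_mxM.
  rewrite mul_mx_scalar !mul_scalar_mx expr2 scale_scalar_mx.
  by rewrite opprD addrACA mul_mx_scalar addrC addrA subrK.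
move=> cAB; apply: char_poly_eq_trace; apply/polyP => i.
have: char_poly (A *m A) \Po 'X^2 = char_poly (B *m B) \Po 'X^2.
  by rewrite !sqE cAB.
move/(congr1 (fun p : {poly F} => p`_(2 * i))).
by rewrite !coef_comp_poly_Xn // dvdn_mulr // mulKn.
Qed.

(** * Matrices of rank at most one *)

Lemma rank_le1P (F : fieldType) (m n : nat) (X : 'M[F]_(m, n)) :
  reflect (exists u : 'cV_m, exists v : 'rV_n, X = u *m v) (\rank X <= 1)%N.
Proof.
apply: (iffP idP) => [|[u [v ->]]]; last first.
  exact: leq_trans (mxrankM_maxl _ _) (rank_leq_col _).
rewrite leq_eqVlt ltnS leqn0 mxrank_eq0 => /orP[/eqP rX | /eqP->].
  by move: (col_base X) (row_base X) (mulmx_base X); rewrite rX => u v <-;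
     exists u, v.
by exists 0, 0; rewrite mul0mx.
Qed.

Lemma rank_le1_minorsP (F : fieldType) (m n : nat) (X : 'M[F]_(m, n)) :
  reflect (forall i j k l, X i j * X k l = X i l * X k j) (\rank X <= 1)%N.
Proof.
apply: (iffP (rank_le1P X)) => [[u [v ->]] i j k l | minX].
  by rewrite !mxE !big_ord1; ring.
have [->|] := eqVneq X 0; first by exists 0, 0; rewrite mul0mx.
case/matrix0Pn => i0 [j0 nz]; exists (col j0 X), ((X i0 j0)^-1 *: row i0 X).
apply/matrixP => i j; rewrite !mxE big_ord1 !mxE mulrCA minX.
by field.
Qed.

(** The minor of u v + u' v' on rows i, k and columns j, l factors as a minor
    of (u, u') times a minor of (v, v'). *)
Lemma rank_le1_add (F : fieldType) (m n : nat) (u u' : 'cV[F]_m)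
    (v v' : 'rV[F]_n) :
  (\rank (u *m v + u' *m v')%R <= 1)%N ->
  (forall i k, u i 0 * u' k 0 = u k 0 * u' i 0) \/
  (forall j l, v 0 j * v' 0 l = v 0 l * v' 0 j).
Proof.
move/rank_le1_minorsP => minX.
have [|/existsNP[i /existsNP[k neq]]] :=
  pselect (forall i k, u i 0 * u' k 0 = u k 0 * u' i 0); first by left.
right=> j l; have := minX i j k l; rewrite !mxE !big_ord1 => E.
have {}neq : u i 0 * u' k 0 - u k 0 * u' i 0 != 0.
  by rewrite subr_eq0; apply/eqP.
apply/eqP; rewrite -subr_eq0; apply/eqP/(mulfI neq); rewrite mulr0.
by move/eqP: E; rewrite -subr_eq0 => /eqP <-; ring.
Qed.

Lemma cV_left_inverse (F : fieldType) (m : nat) (u : 'cV[F]_m) :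
  u != 0 -> exists r : 'rV_m, r *m u = 1%:M.
Proof.
case/matrix0Pn => i [j]; rewrite (ord1 j) => nz.
exists ((u i 0)^-1 *: delta_mx 0 i); rewrite -scalemxAl -rowE.
by apply/matrixP => a b; rewrite !ord1 !mxE mulVf.
Qed.

Lemma cV_collinear (F : fieldType) (m : nat) (u u' : 'cV[F]_m) :
  u != 0 -> (forall i k, u i 0 * u' k 0 = u k 0 * u' i 0) ->
  exists a, u' = a *: u.
Proof.
case/matrix0Pn => i [j]; rewrite (ord1 j) => nz col.
exists ((u i 0)^-1 * u' i 0); apply/matrixP => k l; rewrite (ord1 l) !mxE.
by apply: (mulfI nz); rewrite col; field.
Qed.

Lemma rV_collinear (F : fieldType) (m : nat) (v v' : 'rV[F]_m) :
  v != 0 -> (forall j l, v 0 j * v' 0 l = v 0 l * v' 0 j) ->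
  exists a, v' = a *: v.
Proof.
rewrite -trmx_eq0 => nz col.
have [|a /(congr1 trmx)] := @cV_collinear _ _ _ v'^T nz.
  by move=> i k; rewrite !mxE.
by rewrite linearZ /= !trmxK => ->; exists a.
Qed.

(** In a linear space of matrices of rank at most one, either all columns or
    all rows lie on one line: otherwise two of its members would have a sum of
    rank two. *)
Lemma rank_le1_space (F : fieldType) (p m n : nat)
    (S : {linear 'rV[F]_p -> 'M[F]_(m, n)}) :
  (forall y, (\rank (S y) <= 1)%N) ->
  (exists u : 'cV_m, forall y, exists v : 'rV_n, S y = u *m v) \/
  (exists v : 'rV_n, forall y, exists u : 'cV_m, S y = u *m v).
Proof.
move=> rS.
have [S0|/existsNP[y0 /eqP nz0]] := pselect (forall y, S y = 0).
  by left; exists 0 => y; exists 0; rewrite S0 mul0mx.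
have /rank_le1P[u0 [v0 E0]] := rS y0.
have nzu0 : u0 != 0 by apply: contraNneq nz0 => z; rewrite E0 z mul0mx.
have nzv0 : v0 != 0 by apply: contraNneq nz0 => z; rewrite E0 z mulmx0.
have dich y : (exists v, S y = u0 *m v) \/ (exists u, S y = u *m v0).
  have /rank_le1P[u [v E]] := rS y.
  have := rS (y0 + y); rewrite linearD E0 E.
  case/rank_le1_add => [/(cV_collinear nzu0) | /(rV_collinear nzv0)] [a ->].
    by left; exists (a *: v); rewrite -scalemxAl scalemxAr.
  by right; exists (a *: u); rewrite -scalemxAr scalemxAl.
have [|/existsNP[y1 not_u0]] := pselect (forall y, exists v, S y = u0 *m v).
  by left; exists u0.
right; exists v0 => y; case: (dich y) => // -[v E].
have [//|[w E1]] := dich y1.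
have := rS (y1 + y); rewrite linearD E1 E addrC.
case/rank_le1_add => [/(cV_collinear nzu0)[a wE] | cvv].
  by case: not_u0; exists (a *: v0); rewrite E1 wE -scalemxAl scalemxAr.
have [|a ->] := rV_collinear nzv0 (v' := v).
  by move=> j l; rewrite mulrC -cvv mulrC.
by exists (a *: u0); rewrite -scalemxAr scalemxAl.
Qed.

(** * Linear preservers of rank one *)

Lemma eq_linear_rank1 (F : fieldType) (m n : nat) (V : lmodType F)
    (f g : {linear 'M[F]_(m, n) -> V}) :
  (forall (x : 'cV_m) (y : 'rV_n), f (x *m y) = g (x *m y)) ->
  forall X, f X = g X.
Proof.
move=> fg X; rewrite (matrix_sum_delta X) !linear_sum; apply: eq_bigr => i _.
rewrite !linear_sum; apply: eq_bigr => j _; rewrite !linearZ; congr (_ *: _).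
by rewrite -(mul_delta_mx (0 : 'I_1)) fg.
Qed.

Lemma linear_cV_mulmx (F : fieldType) (m n : nat)
    (f : {linear 'cV[F]_m -> 'cV[F]_n}) :
  exists U : 'M_(n, m), forall x, f x = U *m x.
Proof.
exists (\matrix_(i, j) f (delta_mx j 0) i 0) => x.
rewrite {1}(matrix_sum_delta x) linear_sum; apply/colP => i.
rewrite mxE summxE; apply: eq_bigr => j _.
by rewrite big_ord1 linearZ !mxE mulrC.
Qed.

(** Comparing the images of two basis vectors and of their sum shows that all
    the eigenvalues agree. *)
Lemma all_eigenvectors_scalar (F : fieldType) (m : nat)
    (f : {linear 'rV[F]_m.+1 -> 'rV[F]_m.+1}) :
  (forall (y : 'rV_m.+1) j l, y 0 j * f y 0 l = y 0 l * f y 0 j) ->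
  exists h, forall y, f y = h *: y.
Proof.
move=> eig; pose d j : 'rV[F]_m.+1 := delta_mx 0 j.
have fd j l : j != l -> f (d j) 0 l = 0.
  move=> jl; have := eig (d j) j l.
  by rewrite !mxE !eqxx mul1r /= eq_sym (negPf jl) mul0r.
have fdd j l : f (d j) 0 j = f (d l) 0 l.
  have [->//|jl] := eqVneq j l.
  have := eig (d j + d l) j l; rewrite linearD !mxE !eqxx (fd _ _ jl).
  have lj : l != j by rewrite eq_sym.
  rewrite (fd l j) // (negPf jl) (negPf lj) /=.
  by rewrite !addr0 !add0r !mul1r => ->.
exists (f (d 0) 0 0) => y; rewrite {1}(row_sum_delta y) linear_sum.
apply/rowP => l; rewrite summxE (bigD1 l) //= big1 => [|j jl].
  by rewrite addr0 linearZ !mxE (fdd 0 l) mulrC.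
by rewrite linearZ !mxE fd // mulr0.
Qed.

Section RankOnePreserver.

Variables (F : fieldType) (m : nat).
Let M := 'M[F]_m.+2.
Variable T : {linear M -> M}.
Hypothesis T_inj : forall X, T X = 0 -> X = 0.
Hypothesis T_rank : forall X, (\rank X <= 1)%N -> (\rank (T X) <= 1)%N.

Let rank_xy (x : 'cV[F]_m.+2) (y : 'rV[F]_m.+2) : (\rank (x *m y) <= 1)%N.
Proof. by apply/rank_le1P; exists x, y. Qed.

(** Normalise so that T (e y) = u y for one fixed column e. For any x, both
    T (x y) and T ((x + e) y) = T (x y) + u y have rank at most one; the
    minors of the latter show that the rows of T (x y) in a complement of u
    are multiples of y. If one of these rows is nonzero, then the remaining
    row is a multiple of y as well, so T (x y) = z y with z independent of
    y. *)
Let preserver_normal_col (e u : 'cV[F]_m.+2) (r : 'rV_m.+2) x :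
  r *m u = 1%:M -> (forall y : 'rV_m.+2, T (e *m y) = u *m y) ->
  (exists y, (1%:M - u *m r) *m T (x *m y) != 0) ->
  exists z : 'cV_m.+2, forall y, T (x *m y) = z *m y.
Proof.
move=> ru Te [y1 nz1]; set P := 1%:M - u *m r in nz1.
pose N y := T (x *m y).
have minN y i j l : (P *m N y) i j * (r *m N y) 0 l
                    = (P *m N y) i l * (r *m N y) 0 j.
  have /rank_le1P[a [b E]] := T_rank (rank_xy x y).
  by rewrite /N E !mulmxA !mxE !big_ord1; ring.
have Pu : P *m u = 0 by rewrite mulmxBl mul1mx -mulmxA ru mulmx1 subrr.
have colP y i j l : (P *m N y) i j * y 0 l = (P *m N y) i l * y 0 j.
  have : (\rank (u *m y + N y)%R <= 1)%N.
    by rewrite -Te -linearD -mulmxDl; apply: T_rank.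
  case/rank_le1P => a [b E].
  have PE k : (P *m N y) i k = (P *m a) i 0 * b 0 k.
    suff ->: P *m N y = P *m a *m b by rewrite mxE big_ord1.
    by rewrite -mulmxA -E mulmxDr mulmxA Pu mul0mx add0r.
  have rE k : (r *m N y) 0 k = (r *m a) 0 0 * b 0 k - y 0 k.
    suff ->: r *m N y = r *m a *m b - y by rewrite !mxE big_ord1 !mxE.
    by rewrite -mulmxA -E mulmxDr mulmxA ru mul1mx addrC addKr.
  have := minN y i j l; rewrite !rE !PE; set p := (P *m a) i 0.
  set q := (r *m a) 0 0 => E1; apply: oppr_inj; rewrite -!mulrN.
  apply: (addIr (p * q * b 0 j * b 0 l)).
  by transitivity (p * b 0 j * (q * b 0 l - y 0 l)); [|rewrite E1]; ring.
have scal (w : 'rV_m.+2) :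
    (forall (y : 'rV_m.+2) j l, y 0 j * (w *m N y) 0 l = y 0 l * (w *m N y) 0 j) ->
    exists h, forall y, w *m N y = h *: y.
  move=> hw.
  exact: (all_eigenvectors_scalar (f := mulmx w \o (T \o mulmx x)) hw).
have scalP i : exists h, forall y, row i (P *m N y) = h *: y.
  have [|h hE] := scal (row i P).
    move=> y j l; have E k : (row i P *m N y) 0 k = (P *m N y) i k.
      by rewrite -row_mul mxE.
    by rewrite !E mulrC -colP mulrC.
  by exists h => y; rewrite row_mul.
have [i [j0 nzi]] : exists i j, (P *m N y1) i j != 0 by apply/matrix0Pn.
have [h hE] := scalP i.
have nzh : h != 0.
  apply: contraNneq nzi => h0; have /rowP/(_ j0) := hE y1.
  by rewrite h0 scale0r !mxE => ->.
have [h0 h0E] : exists h0, forall y, r *m N y = h0 *: y.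
  apply: scal => y j l; apply: (mulfI nzh).
  have PN k : (P *m N y) i k = h * y 0 k.
    by have /rowP/(_ k) := hE y; rewrite !mxE.
  by rewrite !mulrA -!PN minN.
have [g gE] := choice scalP.
exists (\col_k g k + h0 *: u) => y.
have ->: T (x *m y) = P *m N y + u *m (r *m N y).
  by rewrite mulmxBl mul1mx mulmxA subrK.
rewrite h0E mulmxDl -scalemxAl -scalemxAr; congr (_ + _).
apply/row_matrixP => k; rewrite gE; apply/rowP => j.
by rewrite !mxE big_ord1 !mxE.
Qed.

(** Some x falls under the previous lemma: otherwise T X = u (r T X) for all
    X, and comparing with T (e y) = u y contradicts injectivity. Every other
    column is then the difference of two that do. *)
Lemma preserver_normal (e u : 'cV[F]_m.+2) (r : 'rV_m.+2) :
  e != 0 -> r *m u = 1%:M -> (forall y : 'rV_m.+2, T (e *m y) = u *m y) ->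
  exists U : 'M_m.+2, forall X, T X = U *m X.
Proof.
move=> nze ru Te; set P := 1%:M - u *m r.
have [x1 [y1 nz1]] : exists (x : 'cV_m.+2) (y : 'rV_m.+2), P *m T (x *m y) != 0.
  apply: contrapT => none.
  have [w we [x wx]] : exists2 w : 'rV[F]_m.+2, w *m e = 0
                       & exists x : 'cV_m.+2, w *m x = 1%:M.
    exists (nz_row (kermx e)); first exact/sub_kermxP/nz_row_sub.
    have [|r' r'w] := @cV_left_inverse _ _ (nz_row (kermx e))^T.
      rewrite trmx_eq0 nz_row_eq0 -mxrank_eq0 mxrank_ker subn_eq0 -ltnNge.
      exact: leq_ltn_trans (rank_leq_col _) _.
    by exists r'^T; apply: trmx_inj; rewrite trmx_mul trmxK r'w tr_scalar_mx.
  have E : T (x *m (delta_mx 0 0 : 'rV_m.+2))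
           = T (e *m (r *m T (x *m (delta_mx 0 0 : 'rV_m.+2)))).
    rewrite Te mulmxA; apply/eqP; rewrite -subr_eq0 -{1}[T _]mul1mx -mulmxBl.
    by apply: contrapT => /negP nz; apply: none; exists x, (delta_mx 0 0).
  move/eqP: E; rewrite -subr_eq0 -linearB /= => /eqP/T_inj/(congr1 (mulmx w)).
  rewrite mulmxBr [w *m (e *m _)]mulmxA we mul0mx subr0 mulmx0 mulmxA.
  rewrite wx mul1mx => /matrixP/(_ 0 0); rewrite !mxE => /eqP.
  by rewrite oner_eq0.
have niceP (x : 'cV_m.+2) : (exists y : 'rV_m.+2, P *m T (x *m y) != 0) ->
    exists z : 'cV_m.+2, forall y, T (x *m y) = z *m y.
  exact: preserver_normal_col.
have all_nice (x : 'cV_m.+2) :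
    exists z : 'cV_m.+2, forall y : 'rV_m.+2, T (x *m y) = z *m y.
  have [z1 z1E] := niceP x1 (ex_intro _ y1 nz1).
  have [zx|nzx] := eqVneq (P *m T (x *m y1)) 0; last by apply: niceP; exists y1.
  have [|z zE] := niceP (x + x1).
    by exists y1; rewrite mulmxDl linearD mulmxDr zx add0r.
  exists (z - z1) => y; rewrite mulmxBl -zE -z1E -linearB -mulmxBl.
  by rewrite addrK.
pose d : 'rV[F]_m.+2 := delta_mx 0 0.
have [U UE] := linear_cV_mulmx (mulmxr d^T \o (T \o mulmxr d)).
exists U; apply: (eq_linear_rank1 (g := mulmx U)) => x y.
have [z zE] := all_nice x; rewrite /= mulmxA -UE /= !zE -[z *m d *m _]mulmxA.
rewrite trmx_delta mul_delta_mx; congr (_ *m _).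
suff ->: delta_mx 0 0 = 1%:M :> 'M[F]_1 by rewrite mulmx1.
by apply/matrixP => i j; rewrite !ord1 !mxE.
Qed.

End RankOnePreserver.

Lemma unitmx_inj (F : fieldType) (m : nat) (A : 'M[F]_m) :
  (forall y : 'rV_m, y *m A = 0 -> y = 0) -> A \in unitmx.
Proof.
move=> inj; rewrite -row_free_unit -kermx_eq0.
by apply/rowV0P => y /sub_kermxP/inj.
Qed.

(** The normalisation is harmless: T (e y) = u (y W) with W invertible, so it
    suffices to follow T by multiplication by the inverse of W. *)
Lemma preserver_col (F : fieldType) (m : nat)
    (T : {linear 'M[F]_m.+2 -> 'M[F]_m.+2}) (e u : 'cV[F]_m.+2) :
  (forall X, T X = 0 -> X = 0) ->
  (forall X, (\rank X <= 1)%N -> (\rank (T X) <= 1)%N) ->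
  e != 0 -> (forall y : 'rV_m.+2, exists v : 'rV_m.+2, T (e *m y) = u *m v) ->
  exists U V : 'M_m.+2, forall X, T X = U *m X *m V.
Proof.
move=> T_inj T_rank nze Tu; have [r' r'e] := cV_left_inverse nze.
have e_inj (y : 'rV_m.+2) : e *m y = 0 -> y = 0.
  by move/(congr1 (mulmx r')); rewrite mulmxA r'e mul1mx mulmx0.
have nzu : u != 0.
  apply/eqP => u0; have [v] := Tu (delta_mx 0 0).
  rewrite u0 mul0mx => /T_inj/e_inj/matrixP/(_ 0 0)/eqP.
  by rewrite !mxE oner_eq0.
have [r ru] := cV_left_inverse nzu.
pose W := lin1_mx (mulmx r \o (T \o mulmx e)).
have TE (y : 'rV_m.+2) : T (e *m y) = u *m (y *m W).
  have [v E] := Tu y.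
  by rewrite mul_rV_lin1 /= E mulmxA mulmxA -[u *m r *m u]mulmxA ru mulmx1.
have uW : W \in unitmx.
  apply: unitmx_inj => y yW; apply/e_inj/T_inj.
  by rewrite TE yW mulmx0.
have [||y|U UE] := @preserver_normal _ _ (mulmxr (invmx W) \o T) _ _ e u r nze ru.
- move=> X /= /(congr1 (mulmxr W)) /=; rewrite mulmxKV // mul0mx.
  exact: T_inj.
- move=> X rX /=; apply: leq_trans (mxrankM_maxl _ _) _; exact: T_rank.
- by rewrite /= TE mulmxA mulmxK.
by exists U, W => X; rewrite -UE /= mulmxKV.
Qed.

(** Marcus and Moyls: the image of the matrices supported on the first column
    is a space of matrices of rank at most one, so it lies in one column or in
    one row; transposition exchanges the two cases. *)
Theorem rank_one_preserver (F : fieldType) (m : nat)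
    (T : {linear 'M[F]_m.+2 -> 'M[F]_m.+2}) :
  (forall X, T X = 0 -> X = 0) ->
  (forall X, (\rank X <= 1)%N -> (\rank (T X) <= 1)%N) ->
  exists U V : 'M_m.+2, [/\ U \in unitmx, V \in unitmx &
    (forall X, T X = U *m X *m V) \/ (forall X, T X = U *m X^T *m V)].
Proof.
move=> T_inj T_rank.
have units (U V : 'M[F]_m.+2) : (forall X, U *m X *m V = 0 -> X = 0) ->
    (U \in unitmx) && (V \in unitmx).
  move=> inj; pose d : 'cV[F]_m.+2 := delta_mx 0 0.
  have [r rd] : exists r : 'rV_m.+2, r *m d = 1%:M.
    by apply/cV_left_inverse/matrix0Pn; exists 0, 0; rewrite !mxE oner_eq0.
  apply/andP; split; last first.
    apply: unitmx_inj => y yV; rewrite -[y]mul1mx -rd -mulmxA.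
    by rewrite [d *m y]inj ?mulmx0 // -!mulmxA yV !mulmx0.
  rewrite -unitmx_tr; apply: unitmx_inj => y yU; apply: trmx_inj.
  rewrite -[y^T]mulmx1 -(trmx1 F 1) -rd trmx_mul mulmxA trmx0.
  rewrite [_ *m d^T]inj ?mul0mx // mulmxA.
  by rewrite -[U]trmxK -trmx_mul yU trmx0 !mul0mx.
pose d : 'cV[F]_m.+2 := delta_mx 0 0.
have nzd : d != 0 by apply/matrix0Pn; exists 0, 0; rewrite !mxE oner_eq0.
have [|[u uE]|[v vE]] := @rank_le1_space _ _ _ _ (T \o mulmx d).
- by move=> y; apply: T_rank; apply/rank_le1P; exists d, y.
- have [U [V E]] := preserver_col T_inj T_rank nzd uE.
  have /andP[uU uV] : (U \in unitmx) && (V \in unitmx).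
    by apply: units => X; rewrite -E; apply: T_inj.
  by exists U, V; split=> //; left.
have [|||U [V E]] := @preserver_col _ _ (trmx \o T) d v^T _ _ nzd.
- by move=> X /= /eqP; rewrite trmx_eq0 => /eqP; apply: T_inj.
- by move=> X rX; rewrite /= mxrank_tr; apply: T_rank.
- by move=> y; have [w /= ->] := vE y; exists w^T; rewrite trmx_mul.
have TE X : T X = V^T *m X^T *m U^T.
  by rewrite -[LHS]trmxK -[(T X)^T]/((trmx \o T) X) E !trmx_mul mulmxA.
have /andP[uU uV] : (U \in unitmx) && (V \in unitmx).
  apply: units => X; rewrite -E /= => /eqP; rewrite trmx_eq0 => /eqP.
  exact: T_inj.
by exists V^T, U^T; rewrite !unitmx_tr; split=> //; right.
Qed.

(** * Pairs of maps preserving a nondegenerate pairing *)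

(** The values on two dual bases form matrices G1 and G2 with G1 G2^T = 1;
    pairing a value of f with the rows of G2 then gives its coordinates on the
    rows of G1. *)
Lemma pairing_preserver_linear (F : fieldType) (N : nat) (T : Type)
    (D : T -> Prop) (a b f g : T -> 'rV[F]_N) :
  (forall u, exists2 s, D s & a s = u) ->
  (forall u, exists2 s, D s & b s = u) ->
  (forall s t, D s -> D t -> f s *m (g t)^T = a s *m (b t)^T) ->
  exists G : 'M_N, [/\ G \in unitmx, forall s, D s -> f s = a s *m G
                     & forall t, D t -> g t = b t *m (invmx G)^T].
Proof.
move=> a_surj b_surj fg.
have dual (h : T -> 'rV[F]_N) : (forall u, exists2 s, D s & h s = u) ->
    exists p : 'I_N -> T, forall i, D (p i) /\ h (p i) = delta_mx 0 i.
  move=> h_surj; suff /choice[p pP] : forall i, exists s, D s /\ h s = delta_mx 0 i.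
    by exists p.
  by move=> i; have [s Ds hs] := h_surj (delta_mx 0 i); exists s.
have [p pP] := dual a a_surj; have [q qP] := dual b b_surj.
pose G1 := \matrix_i f (p i); pose G2 := \matrix_i g (q i).
have fG2 s : D s -> f s *m G2^T = a s.
  move=> Ds; apply/rowP => j; have [Dq bq] := qP j.
  have := fg _ _ Ds Dq; rewrite bq trmx_delta -colE => /matrixP/(_ 0 0).
  by rewrite !mxE => <-; apply: eq_bigr => k _; rewrite !mxE.
have G12 : G1 *m G2^T = 1%:M.
  apply/row_matrixP => i; have [Dp ap] := pP i.
  by rewrite row_mul rowK fG2 // ap rowE mulmx1.
have [uG1 uG2] := mulmx1_unit G12.
have G21 := mulmx1C G12.
have invG1 : invmx G1 = G2^T by rewrite -[LHS]mulmx1 -G12 mulKmx.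
have fE s : D s -> f s = a s *m G1.
  by move=> Ds; rewrite -(fG2 s Ds) -mulmxA G21 mulmx1.
exists G1; split=> // t Dt; apply: trmx_inj.
rewrite invG1 trmxK trmx_mul -[LHS]mul1mx -G21 -mulmxA; congr (_ *m _).
apply/colP => i; have [Dp ap] := pP i.
have := fg _ _ Dp Dt; rewrite (fE _ Dp) ap -mulmxA -!rowE.
by move/matrixP/(_ 0 0); rewrite !mxE.
Qed.

(** * The algebra of block diagonal matrices with blocks of size 1 and m *)

Section BlockDiagonal.

Variables (F : fieldType) (m : nat).
Implicit Types (X Y : 'M[F]_(1 + m)) (u v : 'rV[F]_(1 + m * m)).

(** The off-diagonal blocks are dropped: on block triangular matrices, the
    composite [of_coords \o coords] is the erasure of the upper right block. *)
Definition coords X : 'rV[F]_(1 + m * m) :=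
  row_mx (ulsubmx X) (mxvec (drsubmx X)).

Definition of_coords u : 'M[F]_(1 + m) :=
  block_mx (lsubmx u) 0 0 (vec_mx (rsubmx u)).

Lemma of_coordsK : cancel of_coords coords.
Proof.
by move=> u; rewrite /coords block_mxKul block_mxKdr vec_mxK hsubmxK.
Qed.

Lemma of_coords_block (a : 'M_1) (B : 'M_m) :
  of_coords (row_mx a (mxvec B)) = block_mx a 0 0 B.
Proof. by rewrite /of_coords row_mxKl row_mxKr mxvecK. Qed.

Lemma of_coordsP X : ursubmx X = 0 -> dlsubmx X = 0 -> of_coords (coords X) = X.
Proof. by move=> ur dl; rewrite -[RHS]submxK ur dl of_coords_block. Qed.

Lemma of_coords_tr X : of_coords (coords X^T) = (of_coords (coords X))^T.
Proof.
by rewrite !of_coords_block tr_block_mx !trmx0 trmx_ulsub trmx_drsub.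
Qed.

Lemma mxvec_dot (A B : 'M[F]_m) :
  mxvec A *m (mxvec B)^T = (\tr (A *m B^T))%:M.
Proof.
apply/matrixP => i j; rewrite !ord1 !mxE /= mulr1n.
rewrite (reindex _ (curry_mxvec_bij _ _)) /=; under [RHS]eq_bigr do rewrite mxE.
rewrite [RHS]pair_bigA /=; apply: eq_bigr => -[k l] _.
by rewrite !mxE !mxvecE.
Qed.

(** For block triangular matrices, the trace of a product is the standard
    bilinear form of the coordinates, up to a transposition. *)
Lemma mxtrace_coords X Y : dlsubmx X = 0 -> dlsubmx Y = 0 ->
  coords X *m (coords Y^T)^T = (\tr (X *m Y))%:M.
Proof.
move=> dlX dlY; rewrite -[X]submxK -[Y]submxK dlX dlY mulmx_block.
rewrite tr_block_mx /coords !block_mxKul !block_mxKdr tr_row_mx mul_row_col.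
rewrite !mul0mx !mulmx0 !addr0 add0r mxtrace_block raddfD /=; congr (_ + _).
  by rewrite trmxK [LHS]mx11_scalar trace_mx11.
by rewrite mxvec_dot trmxK.
Qed.

Lemma rank_block_le1 (a : 'M[F]_1) (B : 'M_m) :
  (\rank (block_mx a 0 0 B) <= 1)%N = (a == 0) && (\rank B <= 1)%N || (B == 0).
Proof.
apply/idP/idP => [/rank_le1_minorsP minX|].
  have [->|nzB] := eqVneq B 0; first by rewrite orbT.
  have [i [j nz]] := matrix0Pn _ nzB; rewrite orbF; apply/andP; split.
    apply/eqP/matrixP => k l; rewrite !ord1 mxE; apply: (mulIf nz).
    have := minX (lshift m 0) (lshift m 0) (rshift 1 i) (rshift 1 j).
    by rewrite block_mxEul block_mxEdr block_mxEur block_mxEdl !mxE !mul0r.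
  apply/rank_le1_minorsP => i1 j1 k1 l1.
  have := minX (rshift 1 i1) (rshift 1 j1) (rshift 1 k1) (rshift 1 l1).
  by rewrite !block_mxEdr.
case/orP => [/andP[/eqP-> /rank_le1P[u [v ->]]]|/eqP->]; apply/rank_le1P.
  exists (col_mx 0 u), (row_mx 0 v).
  by rewrite mul_col_row !mul0mx mulmx0.
exists (col_mx 1%:M 0), (row_mx a 0).
by rewrite mul_col_row !mul1mx !mul0mx.
Qed.

End BlockDiagonal.

Lemma rV_noncollinear (F : fieldType) (m : nat) (y : 'rV[F]_m.+2) :
  exists y', forall a, y' != a *: y.
Proof.
have [|/existsNP[y' none]] := pselect (forall y', exists a, y' = a *: y).
  move=> all_y; have [a /rowP aE] := all_y (delta_mx 0 0).
  have [b /rowP bE] := all_y (delta_mx 0 1).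
  have := aE 0; have := aE 1; have := bE 1.
  rewrite !mxE !eqxx /= => b1 /esym/eqP; rewrite mulf_eq0 => /orP[]/eqP.
    by move=> -> /eqP; rewrite mul0r oner_eq0.
  by move=> y1 _; move/eqP: b1; rewrite y1 mulr0 oner_eq0.
by exists y' => a; apply: contra_notN none => /eqP ->; exists a.
Qed.

Section BlockPreserver.

Variables (F : fieldType) (m : nat) (G : 'M[F]_(1 + m * m)).
Hypothesis G_unit : G \in unitmx.
Hypothesis G_rank : forall u, (\rank (of_coords u) <= 1)%N ->
  (\rank (of_coords (u *m G)) <= 1)%N.

Lemma of_coords_mul (a : 'M_1) (v : 'rV_(m * m)) :
  of_coords (row_mx a v *m G) =
    block_mx (a *m ulsubmx G + v *m dlsubmx G) 0 0
             (vec_mx (a *m ursubmx G + v *m drsubmx G)).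
Proof.
rewrite -{1}[G]submxK mul_row_block /of_coords.
by rewrite row_mxKl row_mxKr.
Qed.

Lemma block_row_inj (v : 'rV_(m * m)) :
  v *m dlsubmx G = 0 -> v *m drsubmx G = 0 -> v = 0.
Proof.
move=> vl vr; have : row_mx 0 v *m G = 0.
  by rewrite -[G]submxK mul_row_block !mul0mx !add0r vl vr row_mx0.
move/(congr1 (mulmx^~ (invmx G))); rewrite mulmxK // mul0mx -row_mx0.
by case/eq_row_mx.
Qed.

(** An element (a, v) of rank at most one has a = 0 or v = 0, and the same holds
    for its image. *)
Lemma preserver_split (a : 'M_1) (v : 'rV_(m * m)) :
  a = 0 /\ (\rank (vec_mx v) <= 1)%N \/ v = 0 ->
  a *m ulsubmx G + v *m dlsubmx G = 0 \/ a *m ursubmx G + v *m drsubmx G = 0.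
Proof.
move=> av; have : (\rank (of_coords (row_mx a v)) <= 1)%N.
  rewrite /of_coords row_mxKl row_mxKr rank_block_le1.
  by case: av => [[-> ->]|->]; rewrite ?eqxx // linear0 eqxx orbT.
move/G_rank; rewrite of_coords_mul rank_block_le1.
case/orP => [/andP[/eqP->]|/eqP/(congr1 mxvec)]; first by left.
by rewrite vec_mxK linear0; right.
Qed.

End BlockPreserver.

(** Suppose the image of (0, x y) has a nonzero scalar part; its block part
    then vanishes. Take y' not collinear with y. If the block part at x y' is
    nonzero, the image of (0, x (y + y')) has both parts nonzero. Otherwise a
    combination of (0, x y) and (0, x y') is mapped to 0. *)
Lemma block_preserver_dl (F : fieldType) (k : nat)
    (G : 'M[F]_(1 + k.+2 * k.+2)) :
  G \in unitmx ->
  (forall u, (\rank (of_coords u) <= 1)%N ->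
     (\rank (of_coords (u *m G)) <= 1)%N) ->
  dlsubmx G = 0.
Proof.
move=> uG rG; pose f : {linear 'M[F]_k.+2 -> 'M[F]_(1, 1)} :=
  mulmxr (dlsubmx G) \o (@mxvec F k.+2 k.+2).
pose g : {linear 'M[F]_k.+2 -> 'M[F]_(1, k.+2 * k.+2)} :=
  mulmxr (drsubmx G) \o (@mxvec F k.+2 k.+2).
have fg0 (x : 'cV_k.+2) (y : 'rV_k.+2) : f (x *m y) = 0 \/ g (x *m y) = 0.
  have [||] := preserver_split rG (a := 0) (v := mxvec (x *m y)).
  - by left; split=> //; rewrite mxvecK; apply/rank_le1P; exists x, y.
  - by rewrite mul0mx add0r; left.
  - by rewrite mul0mx add0r; right.
have fg_inj X : f X = 0 -> g X = 0 -> X = 0.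
  by move=> fX gX; rewrite -[X]mxvecK (block_row_inj uG fX gX) linear0.
suff f0 (X : 'M_k.+2) : f X = 0.
  apply/row_matrixP => i; rewrite row0 rowE -[delta_mx 0 i]vec_mxK.
  exact: f0.
apply: (eq_linear_rank1 (g := \0)) => x y; apply: contrapT => /= nzf.
have gxy : g (x *m y) = 0 by case: (fg0 x y) => [/nzf|].
have [y' y'y] := rV_noncollinear y.
have [gxy'|nzg] := eqVneq (g (x *m y')) 0.
  pose s := f (x *m y) 0 0; pose t := f (x *m y') 0 0.
  have nzs : s != 0.
    apply: contra_not_neq nzf => s0.
    by apply/matrixP => i j; rewrite !ord1 [RHS]mxE.
  have x_inj (z : 'rV_k.+2) : x *m z = 0 -> z = 0.
    have nzx : x != 0.
      by apply/eqP => x0; case: nzf; rewrite x0 mul0mx linear0 ?mul0mx.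
    have [r rx] := cV_left_inverse nzx.
    by move/(congr1 (mulmx r)); rewrite mulmxA rx mul1mx mulmx0.
  have /x_inj : x *m (s *: y' - t *: y) = 0.
    rewrite mulmxBr -!scalemxAr; apply: fg_inj; rewrite linearB 2!linearZ_LR.
      rewrite [f (x *m y')]mx11_scalar [f (x *m y)]mx11_scalar -/s -/t.
      by rewrite !scale_scalar_mx mulrC subrr.
    by rewrite gxy gxy' !scaler0 subrr.
  move/eqP; rewrite subr_eq0 => /eqP/(congr1 ( *:%R s^-1)).
  rewrite scalerK // scalerA => E.
  by have := y'y (s^-1 * t); rewrite E eqxx.
have fxy' : f (x *m y') = 0 by case: (fg0 x y') => // /eqP; rewrite (negPf nzg).
case: (fg0 x (y + y')); rewrite mulmxDr linearD ?fxy' ?gxy.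
  by rewrite addr0 => /nzf.
by rewrite add0r => /eqP; rewrite (negPf nzg).
Qed.

(** The scalar part of the image of (0, B) vanishes, so B alone undergoes an
    injective preserver of rank one; the block part of the image of (1, 0) then
    vanishes because its scalar part does not. *)
Theorem block_preserver (F : fieldType) (k : nat)
    (G : 'M[F]_(1 + k.+2 * k.+2)) :
  G \in unitmx ->
  (forall u, (\rank (of_coords u) <= 1)%N ->
     (\rank (of_coords (u *m G)) <= 1)%N) ->
  exists (a : 'M[F]_1) (U V : 'M_k.+2),
    [/\ a \in unitmx, U \in unitmx, V \in unitmx &
     (forall u, of_coords (u *m G)
        = block_mx a 0 0 U *m of_coords u *m block_mx 1%:M 0 0 V) \/
     (forall u, of_coords (u *m G)
        = block_mx a 0 0 U *m (of_coords u)^T *m block_mx 1%:M 0 0 V)].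
Proof.
move=> uG rG; have dl := block_preserver_dl uG rG.
have [ua udr] : ulsubmx G \in unitmx /\ drsubmx G \in unitmx.
  apply/andP; have := uG; rewrite -{1}[G]submxK dl.
  by rewrite !unitmxE det_ublock unitrM.
have ur : ursubmx G = 0.
  have := preserver_split rG (a := 1%:M) (v := 0) (or_intror (erefl _)).
  rewrite !mul1mx !mul0mx !addr0; case=> // E; move: ua.
  by rewrite E unitmxE det0 unitr0.
pose T : {linear 'M[F]_k.+2 -> 'M[F]_k.+2} :=
  (@vec_mx F k.+2 k.+2) \o (mulmxr (drsubmx G) \o (@mxvec F k.+2 k.+2)).
have TE u : of_coords (u *m G)
    = block_mx (ulsubmx G *m lsubmx u) 0 0 (T (vec_mx (rsubmx u))).
  rewrite -{1}[u]hsubmxK of_coords_mul dl ur !mulmx0 addr0 add0r /T /= vec_mxK.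
  congr block_mx; rewrite [lsubmx u]mx11_scalar [ulsubmx G]mx11_scalar.
  by rewrite scalar_mxC.
have [|X rX|U [V [uU uV TUV]]] := @rank_one_preserver _ _ T.
- move=> X /= /(congr1 mxvec); rewrite vec_mxK linear0.
  move/(congr1 (mulmx^~ (invmx (drsubmx G)))); rewrite mulmxK // mul0mx.
  by move/(congr1 vec_mx); rewrite mxvecK linear0.
- have [->|nzT] := eqVneq (T X) 0; first by rewrite mxrank0.
  have := rG (row_mx 0 (mxvec X)); rewrite TE !row_mxKl !row_mxKr mxvecK.
  rewrite of_coords_block !rank_block_le1 mulmx0 eqxx rX (negPf nzT) orbF.
  exact.
exists (ulsubmx G), U, V; split=> //.
case: TUV => TUV; [left | right] => u; rewrite TE TUV /of_coords ?tr_block_mx;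
rewrite !mulmx_block !(mulmx0, mul0mx, addr0, add0r, trmx0) !mulmx1 //.
by rewrite [(lsubmx u)^T]mx11_scalar mxE -mx11_scalar.
Qed.

Lemma vec_mx11 (F : nzRingType) (v : 'rV[F]_(1 * 1)) : vec_mx v = v :> 'M_1.
Proof. by apply/matrixP => i j; rewrite mxE [mxvec_index _ _]ord1 !ord1. Qed.

(** For m = 1 the elements of rank at most one form the two coordinate axes,
    which a linear bijection preserves or exchanges. *)
Lemma block_preserver1 (F : fieldType) (G : 'M[F]_(1 + 1 * 1)) :
  G \in unitmx ->
  (forall u, (\rank (of_coords u) <= 1)%N ->
     (\rank (of_coords (u *m G)) <= 1)%N) ->
  exists a b : 'M[F]_1, [/\ a \in unitmx, b \in unitmx &
     (forall u, of_coords (u *m G) = block_mx a 0 0 b *m of_coords u) \/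
     (forall u, of_coords (u *m G) = block_mx a 0 0 b *m
        block_mx (rsubmx u : 'M_1) 0 0 (lsubmx u))].
Proof.
have mul11C (p q : 'M[F]_1) : p *m q = q *m p.
  by rewrite [p]mx11_scalar [q]mx11_scalar scalar_mxC.
move=> uG rG.
have axis_l : ulsubmx G = 0 \/ ursubmx G = 0.
  have := preserver_split rG (a := 1%:M) (v := 0) (or_intror (erefl _)).
  by rewrite !mul1mx !mul0mx !addr0.
have axis_r : dlsubmx G = 0 \/ drsubmx G = 0.
  have := preserver_split rG (a := 0) (v := 1%:M : 'M[F]_1).
  rewrite !mul0mx !add0r !(@mul1mx F 1); apply.
  by left; split=> //; apply: rank_leq_row.
have G_row (v : 'cV_(1 + 1 * 1)) : G *m v = 0 -> v = 0.
  by move/(congr1 (mulmx (invmx G))); rewrite mulKmx // mulmx0.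
have nz1 : (1%:M : 'M[F]_1) <> 0 by move/eqP; rewrite -mxrank_eq0 mxrank1.
have ofE u : of_coords (u *m G) =
    block_mx (lsubmx u *m ulsubmx G + rsubmx u *m dlsubmx G) 0 0
             (lsubmx u *m ursubmx G + rsubmx u *m drsubmx G).
  by rewrite -{1}[u]hsubmxK of_coords_mul vec_mx11.
case: axis_l axis_r => l0 [] r0.
- have /eq_col_mx[/nz1//] : col_mx (1%:M : 'M[F]_1) (0 : 'M_(1 * 1, 1)) = col_mx 0 0.
  rewrite col_mx0; apply: G_row.
  by rewrite -[G]submxK l0 r0 mul_block_col !mulmx0 !mul0mx !addr0 col_mx0.
- exists (dlsubmx G), (ursubmx G).
  have : G *m block_mx 0 (1%:M : 'M[F]_1) (1%:M : 'M[F]_1) 0 \in unitmx.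
    rewrite unitmx_mul uG /=.
    by apply: (proj1 (mulmx1_unit (B := block_mx 0 1%:M 1%:M 0) _));
       rewrite mulmx_block !mulmx0 !mulmx1 !addr0 !add0r -scalar_mx_block.
  rewrite -{1}[G]submxK l0 r0 mulmx_block !mulmx0 !mul0mx !mulmx1 !addr0 !add0r.
  rewrite block_diag_mx_unit => /andP[-> ->]; split=> //; right => u.
  rewrite ofE l0 r0 mulmx_block !mulmx0 !mul0mx !addr0 !add0r.
  by congr block_mx; apply: mul11C.
- exists (ulsubmx G), (drsubmx G).
  have := uG; rewrite -{1}[G]submxK l0 r0 block_diag_mx_unit => /andP[-> ->].
  split=> //; left => u.
  rewrite ofE l0 r0 mulmx_block !mulmx0 !mul0mx !addr0 !add0r vec_mx11.
  by congr block_mx; apply: mul11C.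
- have /eq_col_mx[_ /nz1//] : col_mx (0 : 'M[F]_1) (1%:M : 'M_(1 * 1)) = col_mx 0 0.
  rewrite col_mx0; apply: G_row.
  by rewrite -[G]submxK l0 r0 mul_block_col !mulmx0 !mul0mx !addr0 col_mx0.
Qed.

(** * The spans of the stochastic matrices *)

Lemma linear_span_linear (R : nzRingType) (V W : lmodType R)
    (f : {linear V -> W}) (S : set V) (w : W) :
  (forall v, S v -> f v = w) ->
  forall v, linear_span S v -> exists c, f v = c *: w.
Proof.
move=> fS v [k [c [s [sS ->]]]]; exists (\sum_i c i).
rewrite linear_sum scaler_suml; apply: eq_bigr => i _.
by rewrite linearZ fS.
Qed.

Section StochasticSpans.

Variables (R : realType) (n : nat).
Implicit Types A : 'M[R]_n.+1.
Let e : 'cV[R]_n.+1 := const_mx 1.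

Lemma mul_const1E A i : (A *m e) i 0 = \sum_j A i j.
Proof. by rewrite mxE; apply: eq_bigr => j _; rewrite mxE mulr1. Qed.

(** Adding a large multiple of the all-ones matrix makes A positive, so A
    is a combination of a stochastic matrix and the uniform one. *)
Lemma shift_to_nonneg A c : A *m e = c *: e ->
  exists s t : R, exists2 B : 'M_n.+1,
    [/\ forall i j, 0 <= B i j, forall i, \sum_j B i j = 1 &
        forall i, \sum_j A j i = c -> \sum_j B j i = 1]
    & A = s *: B - t *: const_mx n.+1%:R^-1.
Proof.
move=> Ae; pose t : R := 1 + \sum_i \sum_j `|A i j|.
have rowA i : \sum_j A i j = c by rewrite -mul_const1E Ae !mxE mulr1.
have Bpos i j : 0 < A i j + t.
  have : `|A i j| <= \sum_i \sum_j `|A i j|.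
    rewrite (bigD1 i) //= (bigD1 j) //= -addrA ler_wpDr // addr_ge0 //.
      by apply: sumr_ge0.
    by apply: sumr_ge0 => k _; apply: sumr_ge0.
  by have := ler_norm (- A i j); rewrite normrN /t; lra.
have sumBE (f : 'I_n.+1 -> R) : \sum_j (f j + t) = (\sum_j f j) + n.+1%:R * t.
  by rewrite big_split /= sumr_const card_ord mulr_natl.
pose s := c + n.+1%:R * t.
have s_gt0 : 0 < s.
  rewrite /s -(rowA 0) -sumBE (bigD1 0) //= ltr_pwDl ?Bpos //.
  by apply: sumr_ge0 => j _; apply: ltW.
exists s, (n.+1%:R * t), (s^-1 *: \matrix_(i, j) (A i j + t)); last first.
  rewrite scalerA mulfV ?gt_eqF // scale1r; apply/matrixP => i j.
  by rewrite !mxE mulrAC mulfV ?pnatr_eq0 // mul1r addrK.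
have scale_sum (f : 'I_n.+1 -> R) :
    \sum_j f j = c -> \sum_j s^-1 * (f j + t) = 1.
  by move=> fc; rewrite -mulr_sumr sumBE fc mulVf ?gt_eqF.
split=> [i j|i|i Ai].
- by rewrite !mxE mulr_ge0 ?invr_ge0 // ltW.
- by under eq_bigr do rewrite !mxE; apply: scale_sum.
- by under eq_bigr do rewrite !mxE; apply: scale_sum.
Qed.

Let linear_span2 (V : lmodType R) (S : set V) (x y : V) (a b : R) :
  S x -> S y -> linear_span S (a *: x + b *: y).
Proof.
move=> Sx Sy; exists 2%N, (fun i => if i == 0 then a else b).
exists (fun i => if i == 0 then x else y); split; first by move=> i; case: eqP.
by rewrite big_ord_recl big_ord1.
Qed.

Let sum_uniform : \sum_(j < n.+1) (const_mx n.+1%:R^-1 : 'rV[R]_n.+1) 0 j = 1.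
Proof.
under eq_bigr do rewrite mxE.
by rewrite sumr_const card_ord -[_ *+ _]mulr_natl mulfV ?pnatr_eq0.
Qed.

Lemma spanRSP A : spanRS A <-> exists c, A *m e = c *: e.
Proof.
split.
  apply: (linear_span_linear (f := mulmxr e)) => B [_ B1] /=.
  by apply/colP => i; rewrite mul_const1E B1 mxE.
case=> c /shift_to_nonneg[s [t [B [B0 B1 _] ->]]]; rewrite -scaleNr.
apply: linear_span2; split=> // i; last rewrite -[RHS]sum_uniform.
  by move=> j; rewrite mxE invr_ge0.
by apply: eq_bigr => j _; rewrite !mxE.
Qed.

(** The row sums c and the column sums d agree because n c and n d are both the
    sum of all entries. *)
Lemma spanDSP A : spanDS A <-> spanRS A /\ spanRS A^T.
Proof.
split=> [DS|].
  split; apply/spanRSP.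
    apply: (linear_span_linear (f := mulmxr e) _ DS) => B [_ B1 _] /=.
    by apply/colP => i; rewrite mul_const1E B1 mxE.
  apply: (linear_span_linear (f := mulmxr e \o trmx) _ DS) => B [_ _ B1] /=.
  apply/colP => i; rewrite mul_const1E mxE -(B1 i).
  by apply: eq_bigr => j _; rewrite mxE.
case=> /spanRSP[c Ae] /spanRSP[d Ad].
have cd : c = d.
  have : (e^T *m (A *m e)) = e^T *m A *m e by rewrite mulmxA.
  have -> : e^T *m A = d *: e^T by rewrite -[LHS]trmxK trmx_mul trmxK Ad linearZ.
  rewrite Ae -scalemxAl -scalemxAr => /matrixP/(_ 0 0).
  rewrite !mxE; apply: mulIf; rewrite (eq_bigr (fun=> 1)) => [|i _].
    by rewrite sumr_const card_ord pnatr_eq0.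
  by rewrite !mxE mulr1.
have [s [t [B [B0 B1 B2] ->]]] := shift_to_nonneg Ae; rewrite -scaleNr.
apply: linear_span2; split=> //.
- move=> i; apply: B2; rewrite cd; have /colP/(_ i) := Ad.
  by rewrite mul_const1E !mxE mulr1 => <-; apply: eq_bigr => j _; rewrite mxE.
- by move=> i j; rewrite mxE invr_ge0.
- by move=> i; rewrite -[RHS]sum_uniform; apply: eq_bigr => j _; rewrite !mxE.
- by move=> i; rewrite -[RHS]sum_uniform; apply: eq_bigr => j _; rewrite !mxE.
Qed.

Lemma R_partE A : let E : 'M[R]_n.+1 := const_mx n.+1%:R^-1 in
  R_part A = E *m A *m (1%:M - E).
Proof.
move=> E; rewrite mulmxBr mulmx1; apply/matrixP => i j.
rewrite !mxE big_ord1 !mxE mul1r mulr_sumr; congr (_ - _).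
  by apply: eq_bigr => k _; rewrite !mxE.
rewrite natrX expr2 invfM exchange_big /= mulr_sumr; apply: eq_bigr => l _.
rewrite !mxE -mulrA mulr_sumr mulr_sumr mulr_suml; apply: eq_bigr => k _.
by rewrite !mxE; ring.
Qed.

End StochasticSpans.

(** * Block coordinates *)

(** The reflection exchanging e and r e0, two vectors of length r with
    r^2 = n; it is along e - r e0, which is nonzero as n > 1. *)
Lemma householder (R : realType) (m : nat) :
  exists (H : 'M[R]_(1 + m.+1)) (r : R),
    [/\ H^T = H, H *m H = 1%:M, r ^+ 2 = m.+2%:R
      & H *m (const_mx 1 : 'cV_(1 + m.+1)) = r *: col_mx 1%:M 0].
Proof.
pose e : 'cV[R]_(1 + m.+1) := const_mx 1; pose e0 : 'cV[R]_(1 + m.+1) := col_mx 1%:M 0.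
pose r : R := Num.sqrt m.+2%:R.
have r2 : r ^+ 2 = m.+2%:R by rewrite sqr_sqrtr ?ler0n.
have nzq : m.+2%:R - r != 0.
  rewrite -r2 -[X in _ - X]mulr1 expr2 -mulrBr mulf_neq0 //.
    by rewrite gt_eqF // sqrtr_gt0 ltr0n.
  rewrite subr_eq0; apply: contraTneq isT => r1.
  by have /eqP := r2; rewrite r1 expr1n -[1]/(1%:R) eqr_nat.
pose w := e - r *: e0.
have ee : e^T *m e = m.+2%:R%:M.
  apply/matrixP => i j; rewrite !ord1 !mxE (eq_bigr (fun=> 1)) => [|k _].
    by rewrite sumr_const card_ord.
  by rewrite !mxE mulr1.
have e0e : e0^T *m e = 1%:M.
  rewrite tr_col_mx trmx1 trmx0 /e -col_mx_const mul_row_col mul0mx mul1mx addr0.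
  by apply/matrixP => i j; rewrite !ord1 !mxE.
have ee0 : e^T *m e0 = 1%:M by rewrite -[LHS]trmxK trmx_mul trmxK e0e trmx1.
have e00 : e0^T *m e0 = 1%:M.
  by rewrite tr_col_mx trmx1 trmx0 mul_row_col mul0mx mul1mx addr0.
have we : w^T *m e = (m.+2%:R - r)%:M.
  rewrite /w linearB linearZ /= mulmxBl -scalemxAl e0e ee.
  by rewrite scale_scalar_mx mulr1 -raddfB.
have we0 : w^T *m e0 = (1 - r)%:M.
  rewrite /w linearB linearZ /= mulmxBl -scalemxAl e00 ee0.
  by rewrite scale_scalar_mx mulr1 -raddfB.
have ww : w^T *m w = (2 * (m.+2%:R - r))%:M.
  rewrite -[X in _ *m X]/(e - r *: e0) mulmxBr -scalemxAr we we0.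
  rewrite scale_scalar_mx -raddfB /=.
  by congr _%:M; rewrite -r2; ring.
have wE : w = e - r *: e0 by [].
clearbody w.
pose k := (m.+2%:R - r)^-1.
exists (1%:M - k *: (w *m w^T)), r; split=> //.
- by rewrite linearB linearZ /= trmx1 trmx_mul trmxK.
- rewrite mulmxBr mulmx1 mulmxBl mul1mx -scalemxAr -scalemxAl.
  rewrite -mulmxA [w^T *m (w *m _)]mulmxA ww mul_scalar_mx -!scalemxAr !scalerA.
  have -> : k * k * (2 * (m.+2%:R - r)) = k + k.
    by rewrite /k; move: nzq; set q := _ - r => nzq; field.
  by rewrite scalerDl opprB addrK subrK.
- rewrite -/e mulmxBl mul1mx -scalemxAl -mulmxA we mul_mx_scalar scalerA.
  by rewrite mulVf // scale1r wE opprB addrC subrK.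
Qed.

Section BlockCoordinates.

Variables (R : realType) (m : nat).
Let n := (1 + m.+1)%N.
Variables (H : 'M[R]_n) (r : R).
Hypothesis H_sym : H^T = H.
Hypothesis H_inv : H *m H = 1%:M.
Hypothesis r2 : r ^+ 2 = m.+2%:R.
Let e : 'cV[R]_n := const_mx 1.
Let e0 : 'cV[R]_n := col_mx 1%:M 0.
Hypothesis H_const : H *m e = r *: e0.
Implicit Types A B : 'M[R]_n.

Definition conj_by (K A : 'M[R]_n) := K *m A *m K.
Local Notation K := (conj_by H).

Lemma conj_byK : involutive K.
Proof.
move=> A; rewrite /conj_by !mulmxA H_inv mul1mx -mulmxA H_inv.
by rewrite mulmx1.
Qed.

Lemma conj_byM A B : K (A *m B) = K A *m K B.
Proof.
by rewrite /conj_by -!mulmxA [H *m (H *m _)]mulmxA H_inv mul1mx.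
Qed.

Lemma conj_by1 : K 1%:M = 1%:M.
Proof. by rewrite /conj_by mulmx1. Qed.

Lemma conj_by_tr A : K A^T = (K A)^T.
Proof. by rewrite /conj_by !trmx_mul H_sym mulmxA. Qed.

Lemma mxtrace_conj_by A : \tr (K A) = \tr A.
Proof. by rewrite /conj_by mxtrace_mulC mulmxA H_inv mul1mx. Qed.

Lemma conj_by_unit A : (K A \in unitmx) = (A \in unitmx).
Proof. by rewrite /conj_by !unitmx_mul (mulmx1_unit H_inv).1 andbT. Qed.

Lemma rank_conj_by A : \rank (K A) = \rank A.
Proof.
rewrite /conj_by mxrankMfree ?row_free_unit ?(mulmx1_unit H_inv).1 //.
by rewrite -mxrank_tr trmx_mul H_sym mxrankMfree ?row_free_unit
  ?(mulmx1_unit H_inv).1 // mxrank_tr.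
Qed.

Lemma invmx_conj_by A : A \in unitmx -> invmx (K A) = K (invmx A).
Proof.
move=> uA; have uKA : K A \in unitmx by rewrite conj_by_unit.
by rewrite -[RHS](mulKmx uKA) -conj_byM mulmxV // conj_by1 mulmx1.
Qed.

Let nz_r : r != 0.
Proof. by rewrite -sqrf_eq0 r2 pnatr_eq0. Qed.

Let He0 : H *m e0 = r^-1 *: e.
Proof.
by rewrite -[e]mul1mx -H_inv -mulmxA H_const -scalemxAr scalerA mulVf ?scale1r.
Qed.

Lemma conj_by_spanRS A : spanRS A <-> dlsubmx (K A) = 0.
Proof.
have KA0 : K A *m e0 = col_mx (ulsubmx (K A)) (dlsubmx (K A)).
  rewrite -{1}[K A]submxK mul_block_col !mulmx0 !mulmx1 !addr0.
  by [].
split=> [/spanRSP[c Ae]|dl].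
  suff : col_mx (ulsubmx (K A)) (dlsubmx (K A)) = col_mx c%:M 0.
    by case/eq_col_mx.
  rewrite -KA0 /conj_by -!mulmxA He0 -!scalemxAr Ae -scalemxAr H_const !scalerA.
  by rewrite mulrAC mulVf // mul1r /e0 scale_col_mx scaler0 scale_scalar_mx mulr1.
apply/spanRSP; exists (ulsubmx (K A) 0 0).
have AE : A = H *m K A *m H by rewrite -[LHS]conj_byK.
have -> : A *m e = r *: (H *m (K A *m e0)).
  by rewrite {1}AE -mulmxA H_const -scalemxAr -mulmxA.
have -> : K A *m e0 = ulsubmx (K A) 0 0 *: e0.
  rewrite KA0 dl scale_col_mx scaler0 scale_scalar_mx mulr1; congr col_mx.
  exact: mx11_scalar.
by rewrite -scalemxAr He0 !scalerA mulrAC mulfV // mul1r.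
Qed.

Lemma conj_by_spanDS A :
  spanDS A <-> dlsubmx (K A) = 0 /\ ursubmx (K A) = 0.
Proof.
rewrite spanDSP !conj_by_spanRS conj_by_tr.
suff -> : dlsubmx (K A)^T = (ursubmx (K A))^T.
  by split=> -[-> ur]; split=> //; apply/eqP; move/eqP: ur; rewrite trmx_eq0.
by apply/matrixP => i j; rewrite !mxE.
Qed.

Lemma spanDS_block (a : 'M_1) (B : 'M_m.+1) : spanDS (K (block_mx a 0 0 B)).
Proof.
by apply/conj_by_spanDS; rewrite conj_byK block_mxKdl block_mxKur.
Qed.

Lemma spanDS_blockE A : spanDS A ->
  exists (a : 'M_1) (B : 'M_m.+1), A = K (block_mx a 0 0 B).
Proof.
move=> /conj_by_spanDS[dl ur]; exists (ulsubmx (K A)), (drsubmx (K A)).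
by rewrite -{1}dl -{1}ur submxK conj_byK.
Qed.

Lemma spanDS_spanRS A : spanDS A -> spanRS A.
Proof. by case/spanDSP. Qed.

(** The matrix with all entries 1/n is the projection onto the constant
    vectors, and becomes the projection onto the first block. *)
Lemma conj_by_R_part A : K (R_part A) = block_mx 0 (ursubmx (K A)) 0 0.
Proof.
have eH : e^T *m H = r *: e0^T.
  by rewrite -[X in _ *m X]H_sym -trmx_mul H_const linearZ.
have KE : K (const_mx n%:R^-1) = block_mx 1%:M 0 0 0.
  have -> : const_mx n%:R^-1 = n%:R^-1 *: (e *m e^T) :> 'M_n.
    by apply/matrixP => i j; rewrite !mxE big_ord1 !mxE mulr1 mulr1.
  rewrite /conj_by -scalemxAr -scalemxAl mulmxA H_const -mulmxA eH.
  rewrite -scalemxAl -scalemxAr !scalerA -mulrA.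
  rewrite -expr2 r2 mulVf ?pnatr_eq0 // scale1r tr_col_mx mul_col_row.
  by rewrite trmx1 trmx0 !mulmx0 !mul0mx mulmx1.
rewrite R_partE !conj_byM KE.
have -> : K (1%:M - const_mx n%:R^-1) = block_mx 0 0 0 1%:M.
  rewrite /conj_by mulmxBr mulmxBl -/(conj_by H 1%:M) conj_by1 -/(K _) KE.
  by rewrite scalar_mx_block opp_block_mx add_block_mx subrr !oppr0 !addr0.
rewrite -{1}[K A]submxK !mulmx_block !mulmx0 !mul0mx !mul1mx !mulmx1 !addr0.
by rewrite !add0r.
Qed.

Lemma conj_by_DS_part A : spanRS A ->
  K (DS_part A) = of_coords (coords (K A)).
Proof.
move/conj_by_spanRS => dl; rewrite /DS_part /conj_by mulmxBr mulmxBl.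
rewrite -/(K A) -/(K (R_part A)) conj_by_R_part -{1}[K A]submxK.
by rewrite opp_block_mx add_block_mx !oppr0 !addr0 subrr dl of_coords_block.
Qed.

End BlockCoordinates.

(** * Maps on the span of the row stochastic matrices *)

Lemma char_poly_ublock (F : comNzRingType) (p q : nat) (A : 'M[F]_p) B (D : 'M_q) :
  char_poly (block_mx A B 0 D) = char_poly A * char_poly D.
Proof.
rewrite /char_poly /char_poly_mx (map_block_mx (@polyC F)) scalar_mx_block.
by rewrite opp_block_mx add_block_mx map_mx0 subrr det_ublock.
Qed.

Lemma mxtrace_trmx_mul_eq0 (R : realDomainType) (p q : nat) (A : 'M[R]_(p, q)) :
  \tr (A^T *m A) = 0 -> A = 0.
Proof.
move=> A0; apply/matrixP => i j; rewrite mxE; apply/eqP.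
have E : \tr (A^T *m A) = \sum_j \sum_i A i j ^+ 2.
  by apply: eq_bigr => k _; rewrite mxE; apply: eq_bigr => l _; rewrite !mxE expr2.
move/eqP: A0; rewrite E psumr_eq0 => [/allP/(_ j)|k _]; last first.
  by apply: sumr_ge0 => l _; apply: sqr_ge0.
rewrite mem_index_enum psumr_eq0 => [/(_ isT)/allP/(_ i)|k _]; last exact: sqr_ge0.
by rewrite mem_index_enum sqrf_eq0 => /(_ isT).
Qed.

(** The sum of the squares of all 2x2 minors of Y is
    2 (tr (Y Y^T))^2 - 2 tr ((Y Y^T)^2). *)
Lemma rank_le1_gram (R : realFieldType) (n : nat) (Y : 'M[R]_n) :
  (\tr (Y *m Y^T)) ^+ 2 = \tr (Y *m Y^T *m (Y *m Y^T)) -> (\rank Y <= 1)%N.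
Proof.
move=> gramY; apply/rank_le1_minorsP => i j k l; apply/eqP.
rewrite -subr_eq0 -sqrf_eq0.
pose d i k j l := Y i j * Y k l - Y i l * Y k j.
have d0 : \sum_i \sum_k \sum_j \sum_l d i k j l ^+ 2 = 0.
  transitivity (2 * (\tr (Y *m Y^T) ^+ 2 - \tr (Y *m Y^T *m (Y *m Y^T)))); last first.
    by rewrite gramY subrr mulr0.
  pose N i := \sum_j Y i j ^+ 2; pose I i k := \sum_j Y i j * Y k j.
  have trE : \tr (Y *m Y^T) = \sum_i N i.
    by apply: eq_bigr => a _; rewrite mxE; apply: eq_bigr => b _; rewrite !mxE expr2.
  have tr2E : \tr (Y *m Y^T *m (Y *m Y^T)) = \sum_i \sum_k I i k ^+ 2.
    apply: eq_bigr => a _; rewrite mxE; apply: eq_bigr => b _; rewrite !mxE expr2.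
    by congr (_ * _); apply: eq_bigr => c _; rewrite !mxE // mulrC.
  rewrite trE tr2E expr2 mulr_suml -sumrB mulr_sumr; apply: eq_bigr => a _.
  rewrite mulr_sumr -sumrB mulr_sumr; apply: eq_bigr => b _.
  have NN p q : N p * N q = \sum_j \sum_l Y p j ^+ 2 * Y q l ^+ 2.
    by rewrite /N mulr_suml; apply: eq_bigr => c _; rewrite mulr_sumr.
  have II : I a b ^+ 2 = \sum_j \sum_l (Y a j * Y b j) * (Y a l * Y b l).
    by rewrite expr2 /I mulr_suml; apply: eq_bigr => c _; rewrite mulr_sumr.
  transitivity (N a * N b + N b * N a - 2 * I a b ^+ 2); last by ring.
  rewrite !NN II mulr_sumr -big_split -sumrB; apply: eq_bigr => c _ /=.
  rewrite mulr_sumr -big_split -sumrB; apply: eq_bigr => f _ /=.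
  by rewrite /d; ring.
have d_ge0 (a b c f : 'I_n) : 0 <= d a b c f ^+ 2 by apply: sqr_ge0.
have sum0 (f : 'I_n -> R) :
    (forall a, 0 <= f a) -> \sum_a f a = 0 -> forall a, f a = 0.
  move=> f0 /eqP; rewrite psumr_eq0 // => /allP all0 a.
  by apply/eqP; apply: all0; rewrite mem_index_enum.
rewrite -/(d i k j l); apply/eqP.
have /sum0/(_ l) -> // : \sum_l d i k j l ^+ 2 = 0.
apply: (sum0 (fun j => \sum_l d i k j l ^+ 2)) => [a|]; first exact: sumr_ge0.
apply: (sum0 (fun k => \sum_j \sum_l d i k j l ^+ 2)) => [a|].
  by do 2!(apply: sumr_ge0 => ? _).
apply: (sum0 (fun i => \sum_k \sum_j \sum_l d i k j l ^+ 2)) => [a|//].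
by do 3!(apply: sumr_ge0 => ? _).
Qed.

Section StochasticMaps.

Variables (R : realType) (m : nat).
Let n := (1 + m.+1)%N.
Variables (H : 'M[R]_n) (r : R).
Hypothesis H_sym : H^T = H.
Hypothesis H_inv : H *m H = 1%:M.
Hypothesis r2 : r ^+ 2 = m.+2%:R.
Hypothesis H_const : H *m (const_mx 1 : 'cV_n) = r *: col_mx 1%:M 0.
Local Notation K := (conj_by H).
Implicit Types A B X Y : 'M[R]_n.

Let spanRSP' A : spanRS A <-> dlsubmx (K A) = 0 :=
  conj_by_spanRS H_inv r2 H_const A.
Let spanDSP' A := conj_by_spanDS H_sym H_inv r2 H_const A.
Let blockDS := spanDS_block H_sym H_inv r2 H_const.
Let DS_partE A := conj_by_DS_part H_sym H_inv r2 H_const (A := A).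

Lemma DS_part_spanDS A : spanRS A -> spanDS (DS_part A).
Proof.
move=> /DS_partE KA; rewrite -[DS_part A](conj_byK H_inv) KA.
exact: blockDS.
Qed.

Lemma DS_part_id A : spanDS A -> DS_part A = A.
Proof.
move=> DSA; have [dl ur] := (spanDSP' A).1 DSA.
apply: (inv_inj (conj_byK H_inv)).
by rewrite DS_partE ?of_coordsP //; apply: spanDS_spanRS.
Qed.

Lemma spanDS_mul A B : spanDS A -> spanDS B -> spanDS (A *m B).
Proof.
move=> /spanDSP'[dlA urA] /spanDSP'[dlB urB]; apply/spanDSP'.
rewrite (conj_byM H_inv) -[K A]submxK -[K B]submxK dlA urA dlB urB mulmx_block.
by rewrite block_mxKdl block_mxKur !mulmx0 !mul0mx !addr0.
Qed.

Lemma spanDS_tr A : spanDS A -> spanDS A^T.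
Proof. by move=> /spanDSP[? ?]; apply/spanDSP; rewrite trmxK. Qed.

Lemma spanDS_inv A : spanDS A -> A \in unitmx -> spanDS (invmx A).
Proof.
move=> /spanDSP'[dl ur] uA; rewrite -[A](conj_byK H_inv).
have uK : K A \in unitmx by rewrite conj_by_unit.
rewrite (invmx_conj_by H_inv) // -[K A]submxK dl ur invmx_block_diag.
  exact: blockDS.
by rewrite -ur -{1}dl submxK.
Qed.

Lemma spanDS_sub A B : spanDS A -> spanDS B -> spanDS (A - B).
Proof.
move=> /spanDSP'[dlA urA] /spanDSP'[dlB urB]; apply/spanDSP'.
rewrite /conj_by mulmxBr mulmxBl -/(K A) -/(K B).
rewrite -[K A]submxK -[K B]submxK dlA urA dlB urB opp_block_mx add_block_mx.
by rewrite block_mxKdl block_mxKur !subrr.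
Qed.

(** In block coordinates both sides are block triangular with the same
    diagonal blocks. *)
Lemma char_poly_DS_part A B : spanRS A -> spanRS B ->
  char_poly (DS_part A *m DS_part B) = char_poly (A *m B).
Proof.
move=> RSA RSB; have char_polyK X : char_poly (K X) = char_poly X.
  by rewrite /conj_by char_poly_mulC mulmxA H_inv mul1mx.
rewrite -[LHS]char_polyK -[RHS]char_polyK !(conj_byM H_inv) !DS_partE //.
rewrite -[K A in RHS]submxK -[K B in RHS]submxK.
rewrite (spanRSP' A).1 // (spanRSP' B).1 // /coords !of_coords_block !mulmx_block.
by rewrite !mulmx0 !mul0mx !addr0 !add0r !char_poly_ublock.
Qed.

Lemma mxtrace_DS_part A B : spanRS A -> spanRS B ->
  \tr (DS_part A *m DS_part B) = \tr (A *m B).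
Proof. by move=> RSA RSB; apply/char_poly_eq_trace/char_poly_DS_part. Qed.

(** Test against the transpose of X - Y, which belongs to the span too. *)
Lemma spanDS_trace_nondegenerate X Y : spanDS X -> spanDS Y ->
  (forall Z, spanDS Z -> \tr (Z *m X) = \tr (Z *m Y)) -> X = Y.
Proof.
move=> DSX DSY trXY; apply/eqP; rewrite -subr_eq0; apply/eqP.
apply: mxtrace_trmx_mul_eq0; rewrite mulmxBr linearB /= trXY ?subrr //.
by apply/spanDS_tr/spanDS_sub.
Qed.

(** ** Consequences of the trace identity *)

Section TracePreserver.

Variables phi1 phi2 : 'M[R]_n -> 'M[R]_n.
Hypothesis phi1_RS : forall A, spanRS A -> spanRS (phi1 A).
Hypothesis phi2_RS : forall A, spanRS A -> spanRS (phi2 A).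
Hypothesis phi_tr : forall A B, spanRS A -> spanRS B ->
  \tr (phi1 A *m phi2 B) = \tr (A *m B).

Lemma trace_preserver_coords : exists G : 'M[R]_(1 + m.+1 * m.+1),
  [/\ G \in unitmx,
      forall A, spanRS A -> K (DS_part (phi1 A)) = of_coords (coords (K A) *m G)
    & forall Y, spanDS Y -> exists2 A, spanDS A & DS_part (phi2 A) = Y].
Proof.
have DS_of u : spanDS (K (of_coords u)) by apply: blockDS.
pose b A := coords (K A)^T.
have bK v : b (K (of_coords v)^T) = v.
  by rewrite /b (conj_byK H_inv) trmxK of_coordsK.
have bDS v : spanDS (K (of_coords v)^T).
  by rewrite (conj_by_tr H_sym); apply/spanDS_tr.
have [|||G [uG phi1E phi2E]] := @pairing_preserver_linear _ _ _ (@spanRS R n)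
    (fun A => coords (K A)) b (fun A => coords (K (phi1 A))) (fun A => b (phi2 A)).
- move=> u; exists (K (of_coords u)); first exact/spanDS_spanRS.
  by rewrite (conj_byK H_inv) of_coordsK.
- by move=> v; exists (K (of_coords v)^T); first exact/spanDS_spanRS.
- move=> A B RSA RSB; rewrite !mxtrace_coords; try exact/spanRSP'; last 2 first.
  + exact/spanRSP'/phi1_RS.
  + exact/spanRSP'/phi2_RS.
  by rewrite -!(conj_byM H_inv) !(mxtrace_conj_by H_inv) phi_tr.
exists G; split=> // [A RSA|Y DSY].
  by rewrite DS_partE ?phi1E //; apply: phi1_RS.
pose v := b Y *m G^T; exists (K (of_coords v)^T); first exact: bDS.
have RSv := spanDS_spanRS (bDS v).
have : b (phi2 (K (of_coords v)^T)) = b Y.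
  by rewrite phi2E // bK /v -mulmxA -trmx_mul mulVmx // trmx1 mulmx1.
move: (phi2_RS RSv); set A := phi2 _ => RSA bA.
have RSY := spanDS_spanRS DSY.
rewrite -[RHS](DS_part_id DSY); apply: (inv_inj (conj_byK H_inv)).
rewrite !DS_partE //; apply: trmx_inj.
by rewrite -!of_coords_tr -/(b A) -/(b Y) bA.
Qed.

Lemma DS_part_trace A B : spanRS A -> spanRS B ->
  \tr (DS_part (phi1 A) *m DS_part (phi2 B)) = \tr (DS_part A *m DS_part B).
Proof.
move=> RSA RSB; rewrite !mxtrace_DS_part ?phi_tr //.
- exact: phi1_RS.
- exact: phi2_RS.
Qed.

(** The trace identity makes phi2 the inverse of the adjoint of phi1. *)
Lemma adjoint_mulmx P Q : P \in unitmx -> Q \in unitmx ->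
  (forall Y, spanDS Y -> spanDS (invmx Q *m Y *m P)) ->
  (forall A, spanRS A -> DS_part (phi1 A) = P *m DS_part A *m invmx Q) ->
  forall A, spanRS A -> DS_part (phi2 A) = Q *m DS_part A *m invmx P.
Proof.
move=> uP uQ DSQP phi1E A RSA.
suff <- : invmx Q *m DS_part (phi2 A) *m P = DS_part A.
  by rewrite !mulmxA mulmxV // mul1mx mulmxK.
have DS2 := DS_part_spanDS (phi2_RS RSA).
apply: spanDS_trace_nondegenerate; last 1 first.
- move=> Z DSZ; have RSZ := spanDS_spanRS DSZ.
  rewrite -[in RHS](DS_part_id DSZ) -(DS_part_trace RSZ RSA).
  rewrite phi1E // (DS_part_id DSZ).
  by rewrite !mulmxA mxtrace_mulC !mulmxA.
- exact: DSQP.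
- exact: DS_part_spanDS.
Qed.

Lemma adjoint_mulmx_tr P Q : P \in unitmx -> Q \in unitmx ->
  (forall Y, spanDS Y -> spanDS (invmx Q *m Y *m P)) ->
  (forall A, spanRS A -> DS_part (phi1 A) = P *m (DS_part A)^T *m invmx Q) ->
  forall A, spanRS A -> DS_part (phi2 A) = Q *m (DS_part A)^T *m invmx P.
Proof.
move=> uP uQ DSQP phi1E A RSA.
suff -> : DS_part A = (invmx Q *m DS_part (phi2 A) *m P)^T.
  by rewrite trmxK !mulmxA mulmxV // mul1mx mulmxK.
have DS2 := DS_part_spanDS (phi2_RS RSA).
apply: spanDS_trace_nondegenerate; last 1 first.
- move=> Z DSZ; have RSZ := spanDS_spanRS DSZ.
  rewrite -[in LHS](DS_part_id DSZ) -(DS_part_trace RSZ RSA).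
  rewrite phi1E // (DS_part_id DSZ).
  by rewrite -[in RHS]mxtrace_tr trmx_mul trmxK [RHS]mxtrace_mulC !mulmxA
     [RHS]mxtrace_mulC !mulmxA.
- exact: DS_part_spanDS.
- exact/spanDS_tr/DSQP.
Qed.

Hypothesis phi1_rank : forall A, spanDS A -> (\rank A <= 1)%N ->
  (\rank (DS_part (phi1 A)) <= 1)%N.

(** Conjugation by H preserves ranks, so the rank condition passes to the
    induced map on coordinates. *)
Lemma rank_preserver_coords : exists G : 'M[R]_(1 + m.+1 * m.+1),
  [/\ G \in unitmx,
      forall A, spanRS A -> K (DS_part (phi1 A)) = of_coords (coords (K A) *m G)
    & forall u, (\rank (of_coords u) <= 1)%N ->
        (\rank (of_coords (u *m G)) <= 1)%N].
Proof.
have [G [uG phi1E _]] := trace_preserver_coords.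
exists G; split=> // u rk_u; have DSu : spanDS (K (of_coords u)) by apply: blockDS.
rewrite -{1}[u]of_coordsK -{1}[of_coords u](conj_byK H_inv) -phi1E.
  rewrite (rank_conj_by H_sym H_inv) phi1_rank // (rank_conj_by H_sym H_inv).
  exact: rk_u.
exact: spanDS_spanRS.
Qed.
End TracePreserver.
End StochasticMaps.

(** * The classification *)

Section Classification.

Variables (R : realType) (m : nat).
Let n := (1 + m.+1)%N.
Variables phi1 phi2 : 'M[R]_n -> 'M[R]_n.
Hypothesis phi1_RS : forall A, spanRS A -> spanRS (phi1 A).
Hypothesis phi2_RS : forall A, spanRS A -> spanRS (phi2 A).

(** Some phi2 B has DS part Y^T, where Y is the DS part of phi1 A, so the
    characteristic polynomial of Y Y^T is that of A B, which has rank at most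
    one. *)
Lemma spec_rank :
  (forall A B, spanRS A -> spanRS B ->
     char_poly (phi1 A *m phi2 B) = char_poly (A *m B)) ->
  forall A, spanDS A -> (\rank A <= 1)%N -> (\rank (DS_part (phi1 A)) <= 1)%N.
Proof.
move=> phi_char A DSA rA; have [H [r [Hs Hi r2 Hc]]] := householder R m.
have phi_tr B C : spanRS B -> spanRS C -> \tr (phi1 B *m phi2 C) = \tr (B *m C).
  by move=> RSB RSC; apply/char_poly_eq_trace/phi_char.
have [_ [_ _ surj]] := trace_preserver_coords Hs Hi r2 Hc phi1_RS phi2_RS phi_tr.
have RSA := spanDS_spanRS DSA.
have DSY := DS_part_spanDS Hs Hi r2 Hc (phi1_RS RSA).
have [B DSB phiB] := surj _ (spanDS_tr DSY); have RSB := spanDS_spanRS DSB.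
have E : char_poly (DS_part (phi1 A) *m (DS_part (phi1 A))^T) = char_poly (A *m B).
  rewrite -phiB (char_poly_DS_part Hs Hi r2 Hc) ?phi_char //.
  - exact: phi1_RS.
  - exact: phi2_RS.
apply: rank_le1_gram; rewrite (char_poly_eq_trace_sq E) (char_poly_eq_trace E).
have /rank_le1P[u [v ->]] : (\rank (A *m B) <= 1)%N.
  exact: leq_trans (mxrankM_maxl _ _) rA.
have -> : u *m v *m (u *m v) = (v *m u) 0 0 *: (u *m v).
  rewrite mulmxA -[u *m v *m u]mulmxA {1}[v *m u]mx11_scalar mul_mx_scalar.
  by rewrite -scalemxAl.
by rewrite mxtraceZ mxtrace_mulC trace_mx11 expr2.
Qed.

End Classification.

Lemma rank_preserver_large (R : realType) (k : nat)
    (phi1 phi2 : 'M[R]_(1 + k.+2) -> 'M[R]_(1 + k.+2)) :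
  (forall A, spanRS A -> spanRS (phi1 A)) ->
  (forall A, spanRS A -> spanRS (phi2 A)) ->
  (forall A B, spanRS A -> spanRS B -> \tr (phi1 A *m phi2 B) = \tr (A *m B)) ->
  (forall A, spanDS A -> (\rank A <= 1)%N ->
     (\rank (DS_part (phi1 A)) <= 1)%N) ->
  exists P Q : 'M_(1 + k.+2),
    [/\ spanDS P, P \in unitmx, spanDS Q, Q \in unitmx &
       (forall A, spanRS A ->
          DS_part (phi1 A) = P *m DS_part A *m invmx Q /\
          DS_part (phi2 A) = Q *m DS_part A *m invmx P) \/
       (forall A, spanRS A ->
          DS_part (phi1 A) = P *m (DS_part A)^T *m invmx Q /\
          DS_part (phi2 A) = Q *m (DS_part A)^T *m invmx P)].
Proof.
move=> RS1 RS2 phi_tr phi_rk; have [H [r [Hs Hi r2 Hc]]] := householder R k.+1.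
have [G [uG phi1E rG]] := rank_preserver_coords Hs Hi r2 Hc RS1 RS2 phi_tr phi_rk.
have [a [U [V [ua uU uV GE]]]] := block_preserver uG rG.
have DSE (A : 'M_(1 + k.+2)) : spanRS A ->
    of_coords (coords (conj_by H A)) = conj_by H (DS_part A).
  by move=> RSA; rewrite (conj_by_DS_part Hs Hi r2 Hc).
pose P := conj_by H (block_mx a 0 0 U).
pose S := conj_by H (block_mx 1%:M 0 0 V).
have uP : P \in unitmx by rewrite (conj_by_unit Hi) block_diag_mx_unit ua uU.
have uS : S \in unitmx by rewrite (conj_by_unit Hi) block_diag_mx_unit unitmx1 uV.
have DSP : spanDS P by apply: (spanDS_block Hs Hi r2 Hc).
have DSQ : spanDS (invmx S).
  by apply: (spanDS_inv Hs Hi r2 Hc _ uS); apply: (spanDS_block Hs Hi r2 Hc).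
have uQ : invmx S \in unitmx by rewrite unitmx_inv.
have DSQP (Y : 'M_(1 + k.+2)) : spanDS Y -> spanDS (invmx (invmx S) *m Y *m P).
  move=> DSY; rewrite invmxK; apply: (spanDS_mul Hs Hi r2 Hc) => //.
  apply: (spanDS_mul Hs Hi r2 Hc) => //.
  by apply: (spanDS_block Hs Hi r2 Hc).
exists P, (invmx S); split=> //; case: GE => GE; [left | right].
  have E A : spanRS A -> DS_part (phi1 A) = P *m DS_part A *m invmx (invmx S).
    move=> RSA; apply: (inv_inj (conj_byK Hi)).
    by rewrite phi1E // GE DSE // invmxK /P /S 2!(conj_byM Hi) !(conj_byK Hi).
  move=> A RSA; split; first exact: E.
  exact: (adjoint_mulmx Hs Hi r2 Hc RS1 RS2 phi_tr).
have E A : spanRS A -> DS_part (phi1 A) = P *m (DS_part A)^T *m invmx (invmx S).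
  move=> RSA; apply: (inv_inj (conj_byK Hi)).
  rewrite phi1E // GE DSE // invmxK /P /S 2!(conj_byM Hi) !(conj_byK Hi).
  by rewrite (conj_by_tr Hs).
move=> A RSA; split; first exact: E.
exact: (adjoint_mulmx_tr Hs Hi r2 Hc RS1 RS2 phi_tr).
Qed.

(** Conjugation by diag (1, -1) exchanges the constant vectors with the vectors
    of sum zero, hence the two blocks. *)
Lemma alt_sign_swap (R : realType) (H : 'M[R]_(1 + 1)) (r : R) (c d : 'M[R]_1) :
  H^T = H -> H *m H = 1%:M -> r ^+ 2 = 2%:R ->
  H *m (const_mx 1 : 'cV_(1 + 1)) = r *: col_mx 1%:M 0 ->
  alt_sign_mx R (1 + 1) *m conj_by H (block_mx c 0 0 d) *m alt_sign_mx R (1 + 1)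
    = conj_by H (block_mx d 0 0 c).
Proof.
move=> Hs Hi r2 Hc.
have entries (p q : 'M[R]_1) (X := conj_by H (block_mx p 0 0 q)) :
    [/\ X 0 0 = (p 0 0 + q 0 0) / 2, X 1 1 = (p 0 0 + q 0 0) / 2,
        X 0 1 = (p 0 0 - q 0 0) / 2 & X 1 0 = (p 0 0 - q 0 0) / 2].
  have sym11 (s : 'M[R]_1) : s^T = s by rewrite [s]mx11_scalar tr_scalar_mx.
  have symX : X^T = X by rewrite -(conj_by_tr Hs) tr_block_mx !trmx0 !sym11.
  have trX : \tr X = p 0 0 + q 0 0.
    by rewrite (mxtrace_conj_by Hi) mxtrace_block !trace_mx11.
  have Xe : X *m (const_mx 1 : 'cV_(1 + 1)) = p 0 0 *: const_mx 1.
    rewrite /X /conj_by -!mulmxA Hc -!scalemxAr mul_block_col !mulmx1 !mulmx0 !addr0.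
    have -> : col_mx p 0 = p 0 0 *: col_mx 1%:M 0 :> 'cV[R]_(1 + 1).
      by rewrite scale_col_mx scaler0 scale_scalar_mx mulr1 -mx11_scalar.
    by rewrite -scalemxAr scalerA mulrC -scalerA scalemxAr -Hc mulmxA Hi mul1mx.
  clearbody X.
  have l1 : lift ord0 ord0 = 1 :> 'I_(1 + 1) by apply: val_inj.
  have row i : X i 0 + X i 1 = p 0 0.
    have /colP/(_ i) := Xe; rewrite !mxE big_ord_recl big_ord1 !mxE !mulr1 => <-.
    by rewrite l1.
  have X01 : X 0 1 = X 1 0 by rewrite -{1}symX mxE.
  have tr2 : X 0 0 + X 1 1 = p 0 0 + q 0 0.
    by rewrite -trX /mxtrace big_ord_recl big_ord1 l1.
  have r0 := row 0; have r1 := row 1.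
  by split; lra.
have [x00 x11 x01 x10] := entries c d; have [y00 y11 y01 y10] := entries d c.
have altE (X : 'M[R]_(1 + 1)) (i j : 'I_(1 + 1)) :
    (alt_sign_mx R (1 + 1) *m X *m alt_sign_mx R (1 + 1)) i j
    = (-1) ^+ i * X i j * (-1) ^+ j.
  by rewrite /alt_sign_mx mul_mx_diag mxE mul_diag_mx !mxE.
apply/matrixP => i j; rewrite altE.
have ord2 (l : 'I_(1 + 1)) : l = 0 \/ l = 1.
  by case: l => -[|[|//]] ?; [left | right]; apply: val_inj.
by case: (ord2 i) => ->; case: (ord2 j) => ->;
  rewrite ?x00 ?x01 ?x10 ?x11 ?y00 ?y01 ?y10 ?y11 /=; field.
Qed.

Lemma alt_sign_unit (R : realType) (n : nat) :
  alt_sign_mx R n \in unitmx /\ invmx (alt_sign_mx R n) = alt_sign_mx R n.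
Proof.
have alt2 : alt_sign_mx R n *m alt_sign_mx R n = 1%:M.
  rewrite mulmx_diag -diag_const_mx; congr diag_mx; apply/rowP => i.
  by rewrite !mxE -expr2 sqrr_sign.
have [ualt _] := mulmx1_unit alt2.
by split=> //; rewrite -[LHS]mulmx1 -alt2 mulKmx.
Qed.

Lemma invmx_mul (F : comUnitRingType) (n : nat) (A B : 'M[F]_n) :
  A \in unitmx -> B \in unitmx -> invmx (A *m B) = invmx B *m invmx A.
Proof.
move=> uA uB; have uAB : A *m B \in unitmx by rewrite unitmx_mul uA.
apply: (can_inj (mulKmx uAB)); rewrite mulmxV //.
by rewrite -mulmxA [B *m (_ *m _)]mulmxA mulmxV // mul1mx mulmxV.
Qed.

Section SizeTwo.

Variable R : realType.
Local Notation alt := (alt_sign_mx R (1 + 1)).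

Lemma alt_sign_spanDS (X : 'M[R]_(1 + 1)) : spanDS X -> spanDS (alt *m X *m alt).
Proof.
have [H [r [Hs Hi r2 Hc]]] := householder R 0.
case/(spanDS_blockE Hs Hi r2 Hc) => c [d ->].
by rewrite (alt_sign_swap _ _ Hs Hi r2 Hc); apply: (spanDS_block Hs Hi r2 Hc).
Qed.

Lemma spanDS2_comm (X Y : 'M[R]_(1 + 1)) : spanDS X -> spanDS Y -> X *m Y = Y *m X.
Proof.
have [H [r [Hs Hi r2 Hc]]] := householder R 0.
have mul11C (p q : 'M[R]_1) : p *m q = q *m p.
  by rewrite [p]mx11_scalar [q]mx11_scalar scalar_mxC.
case/(spanDS_blockE Hs Hi r2 Hc) => a [b ->].
case/(spanDS_blockE Hs Hi r2 Hc) => c [d ->].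
rewrite -!(conj_byM Hi) !mulmx_block !mulmx0 !mul0mx !addr0 !add0r.
by rewrite (mul11C a) (mul11C b).
Qed.

Lemma rank_preserver_small (phi1 phi2 : 'M[R]_(1 + 1) -> 'M[R]_(1 + 1)) :
  (forall A, spanRS A -> spanRS (phi1 A)) ->
  (forall A, spanRS A -> spanRS (phi2 A)) ->
  (forall A B, spanRS A -> spanRS B -> \tr (phi1 A *m phi2 B) = \tr (A *m B)) ->
  (forall A, spanDS A -> (\rank A <= 1)%N ->
     (\rank (DS_part (phi1 A)) <= 1)%N) ->
  exists C P : 'M_(1 + 1),
    [/\ spanDS C, C \in unitmx, P = 1%:M \/ P = alt &
        forall A, spanRS A ->
          DS_part (phi1 A) = C *m P *m DS_part A *m invmx P /\
          DS_part (phi2 A) = P *m DS_part A *m invmx P *m invmx C].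
Proof.
move=> RS1 RS2 phi_tr phi_rk; have [H [r [Hs Hi r2 Hc]]] := householder R 0.
have [G [uG phi1E rG]] := rank_preserver_coords Hs Hi r2 Hc RS1 RS2 phi_tr phi_rk.
have [a [b [ua ub GE]]] := block_preserver1 uG rG.
have DSE (A : 'M_(1 + 1)) : spanRS A ->
    of_coords (coords (conj_by H A)) = conj_by H (DS_part A).
  by move=> RSA; rewrite (conj_by_DS_part Hs Hi r2 Hc).
pose C := conj_by H (block_mx a 0 0 b).
have uC : C \in unitmx by rewrite (conj_by_unit Hi) block_diag_mx_unit ua ub.
have DSC : spanDS C by apply: (spanDS_block Hs Hi r2 Hc).
have [ualt ialt] := alt_sign_unit R (1 + 1).
suff [P [Pcase phiE]] : exists P, (P = 1%:M \/ P = alt) /\ forall A, spanRS A ->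
    DS_part (phi1 A) = C *m P *m DS_part A *m invmx P.
  have uP : P \in unitmx by case: Pcase => ->; rewrite ?unitmx1.
  exists C, P; split=> // A RSA; split; first exact: phiE.
  have := adjoint_mulmx Hs Hi r2 Hc RS1 RS2 phi_tr (P := C *m P) (Q := P).
  rewrite unitmx_mul uC uP invmx_mul // => /(_ isT isT) -> //; first by rewrite mulmxA.
  move=> Y DSY; have DSYC : spanDS (Y *m C) by apply: (spanDS_mul Hs Hi r2 Hc).
  have -> : invmx P *m Y *m (C *m P) = invmx P *m (Y *m C) *m P.
    by rewrite !mulmxA.
  case: Pcase => ->; first by rewrite invmx1 mul1mx mulmx1.
  by rewrite ialt; apply: alt_sign_spanDS.
case: GE => GE; [exists 1%:M; split; first by left |
                 exists alt; split; first by right].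
  move=> A RSA; apply: (inv_inj (conj_byK Hi)).
  rewrite phi1E // GE DSE // invmx1 !mulmx1 /C (conj_byM Hi).
  by rewrite (conj_byK Hi).
move=> A RSA; apply: (inv_inj (conj_byK Hi)).
set u := coords (conj_by H A) in GE *.
have DSA : DS_part A = conj_by H (block_mx (lsubmx u) 0 0 (rsubmx u : 'M_1)).
  rewrite -[LHS](conj_byK Hi) -DSE // -/u; congr conj_by.
  by rewrite /of_coords vec_mx11.
have -> : C *m alt *m DS_part A *m invmx alt = C *m (alt *m DS_part A *m alt).
  by rewrite ialt !mulmxA.
rewrite phi1E // GE DSA (alt_sign_swap _ _ Hs Hi r2 Hc) /C (conj_byM Hi).
by rewrite !(conj_byK Hi).
Qed.

End SizeTwo.

(** * The equivalence *)

Theorem theorem4p2 (R : realType) (n : nat) (hn : (2 <= n)%N)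
    (phi1 phi2 : {fun @spanRS R n >-> @spanRS R n}) :
  [<->
    (* (1) *)
    forall A1 A2 : 'M[R]_n, spanRS A1 -> spanRS A2 ->
      perm_eq (spec (phi1 A1 *m phi2 A2)) (spec (A1 *m A2));
    (* (2); the rank condition is on the DS component of phi A: on phi A
       itself, (3) would not imply (2) for n >= 3, since (3) leaves the
       R-component of phi A free *)
    (forall A1 A2 : 'M[R]_n, spanRS A1 -> spanRS A2 ->
       \tr (phi1 A1 *m phi2 A2) = \tr (A1 *m A2)) /\
    (exists2 phi : {fun @spanRS R n >-> @spanRS R n},
       phi = phi1 \/ phi = phi2 &
       forall A : 'M[R]_n, spanDS A -> (\rank A <= 1)%N ->
         (\rank (DS_part (phi A)) <= 1)%N);
    (* (3) *)
    (n = 2%N /\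
     exists C P : 'M[R]_n,
       [/\ spanDS C, C \in unitmx, P = 1%:M \/ P = alt_sign_mx R n &
           forall A : 'M[R]_n, spanRS A ->
             DS_part (phi1 A) = C *m P *m DS_part A *m invmx P /\
             DS_part (phi2 A) = P *m DS_part A *m invmx P *m invmx C]) \/
    ((3 <= n)%N /\
     exists P Q : 'M[R]_n,
       [/\ spanDS P, P \in unitmx, spanDS Q, Q \in unitmx &
           (forall A : 'M[R]_n, spanRS A ->
              DS_part (phi1 A) = P *m DS_part A *m invmx Q /\
              DS_part (phi2 A) = Q *m DS_part A *m invmx P) \/
           (forall A : 'M[R]_n, spanRS A ->
              DS_part (phi1 A) = P *m (DS_part A)^T *m invmx Q /\
              DS_part (phi2 A) = Q *m (DS_part A)^T *m invmx P)])].
Proof.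
case: n hn phi1 phi2 => [|[|m]] // _ phi1 phi2.
have [H [r [Hs Hi r2 Hc]]] := householder R m.
have RS1 (A : 'M[R]_m.+2) : spanRS A -> spanRS (phi1 A) by apply: funS.
have RS2 (A : 'M[R]_m.+2) : spanRS A -> spanRS (phi2 A) by apply: funS.
tfae.
- move=> phi_spec; have phi_char (A B : 'M[R]_m.+2) : spanRS A -> spanRS B ->
      char_poly (phi1 A *m phi2 B) = char_poly (A *m B).
    by move=> RSA RSB; apply/spec_perm_eqP/phi_spec.
  split; first by move=> A B RSA RSB; apply/char_poly_eq_trace/phi_char.
  by exists phi1; [left | exact: (spec_rank RS1 RS2 phi_char)].
- case=> phi_tr [phi phiE phi_rk].
  have phi_tr21 (A B : 'M[R]_m.+2) : spanRS A -> spanRS B ->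
      \tr (phi2 A *m phi1 B) = \tr (A *m B).
    by move=> RSA RSB; rewrite mxtrace_mulC phi_tr // mxtrace_mulC.
  case: m => [|m] in H r Hs Hi r2 Hc phi1 phi2 RS1 RS2 phi phi_tr phi_tr21
                     phiE phi_rk *.
    left; split=> //; case: phiE phi_rk => -> phi_rk.
      exact: (rank_preserver_small RS1 RS2 phi_tr phi_rk).
    have [C [P [DSC uC Pcase phiE]]] :=
      rank_preserver_small RS2 RS1 phi_tr21 phi_rk.
    have DSiC : spanDS (invmx C) by apply: (spanDS_inv Hs Hi r2 Hc).
    (* C commutes with P X P^-1, so exchanging the maps amounts to inverting C. *)
    exists (invmx C), P; split; rewrite ?unitmx_inv // => A RSA.
    have [-> ->] := phiE A RSA; rewrite invmxK.
    have DSPA : spanDS (P *m DS_part A *m invmx P).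
      have DSA := DS_part_spanDS Hs Hi r2 Hc RSA.
      case: Pcase => ->; first by rewrite invmx1 mul1mx mulmx1.
      by rewrite (alt_sign_unit R 2).2; apply: alt_sign_spanDS.
    split; first by rewrite spanDS2_comm // !mulmxA.
    by rewrite -[RHS]spanDS2_comm // !mulmxA.
  right; split=> //; case: phiE phi_rk => -> phi_rk.
    exact: (rank_preserver_large RS1 RS2 phi_tr phi_rk).
  have [P [Q [DSP uP DSQ uQ phiE]]] := rank_preserver_large RS2 RS1 phi_tr21 phi_rk.
  exists Q, P; split=> //.
  by case: phiE => phiE; [left | right] => A /phiE[-> ->].
move=> phi_form A B RSA RSB; apply/spec_perm_eqP.
rewrite -(char_poly_DS_part Hs Hi r2 Hc (RS1 A RSA) (RS2 B RSB)).
rewrite -(char_poly_DS_part Hs Hi r2 Hc RSA RSB).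
case: phi_form => [[_ [C [P [_ uC Pcase phiE]]]]|[_ [P [Q [_ uP _ uQ [] phiE]]]]].
- have uP : P \in unitmx.
    by case: Pcase => ->; rewrite ?unitmx1 // (alt_sign_unit R m.+2).1.
  have [-> _] := phiE A RSA; have [_ ->] := phiE B RSB.
  transitivity (char_poly (C *m (P *m (DS_part A *m DS_part B) *m invmx P)
                             *m invmx C)).
    by congr char_poly; rewrite !mulmxA mulmxKV.
  by rewrite !char_poly_conj.
- have [-> _] := phiE A RSA; have [_ ->] := phiE B RSB.
  rewrite -(char_poly_conj (DS_part A *m DS_part B) uP); congr char_poly.
  by rewrite !mulmxA mulmxKV.
- have [-> _] := phiE A RSA; have [_ ->] := phiE B RSB.
  rewrite [RHS]char_poly_mulC -[RHS]char_poly_tr trmx_mul.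
  rewrite -[RHS](char_poly_conj _ uP); congr char_poly.
  by rewrite !mulmxA mulmxKV.
Qed.
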